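(* Let $\epsilon>0$ and $L_f>0$ be given. Suppose an algorithm is applied to problem (P) that satisfies Assumption 1 and generates a sequence $\{(x^{(t)},y^{(t)})\}_{t\ge0}$ that satisfies Assumption 3. Then for any $\omega\in[0,\frac{150\pi\epsilon}{L_f})$, there exists an instance of problem (P), namely instance $\mathcal P$, such that the algorithm requires at least $$\left\lceil \frac{\kappa([\bar A;A])\,L_f\,\Delta_{F_0}}{18000\pi^2}\,\epsilon^{-2}\right\rceil$$ oracles to obtain a point $x^{(t)}$ that is $\omega$-close to an $\epsilon$-stationary point of instance $\mathcal P$, where $\Delta_{F_0}=F_0(x^{(0)})-\inf_xF_0(x)$.
   Context: **Problem (P).** $\min_{x\in\mathbb R^d}F_0(x):=f_0(x)+g(x)$ s.t. $Ax+b=0$, with $A\in\mathbb R^{n\times d}$, $b\in\mathbb R^n$, $f_0:\mathbb R^d\to\mathbb R$ smooth, $g:\mathbb R^d\to\mathbb R\cup\{+\infty\}$ proper lower semicontinuous convex, potentially non-smooth. **Assumption 1.** (a) $\nabla f_0$ is $L_f$-Lipschitz continuous; (b) $\inf_xF_0(x)>-\infty$; (c) $g(x)=\bar g(\bar Ax+\bar b)$ with $\bar A\in\mathbb R^{\bar n\times d}$, $\bar b\in\mathbb R^{\bar n}$, $\bar g:\mathbb R^{\bar n}\to\mathbb R\cup\{+\infty\}$ proper lower semicontinuous convex, potentially non-smooth. **$\epsilon$-stationary point of (P).** $x^*$ such that for some $\gamma\in\mathbb R^n$, $\max\{\mathrm{dist}(0,\nabla f_0(x^* )+A^\top\gamma+\partial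 g(x^* )),\|Ax^*+b\|\}\le\epsilon$. A point $x$ is $\omega$-close to $x^*$ if $\|x-x^*\|\le\omega$. **Assumption 3 (linear span).** There is an oracle that, given any $x\in\mathbb R^d$ and $y,\xi\in\mathbb R^{\bar n}$, returns $(\bar b,A^\top b,\bar A^\top\bar b)$, $(\nabla f_0(x),\bar Ax,A^\top Ax,\bar A^\top\bar Ax,\bar A^\top y)$ and $\mathrm{prox}_{\eta\bar g}(\xi)$ for any $\eta>0$, where $\mathrm{prox}_{\eta\bar g}(y)=\arg\min_{y'}\{\bar g(y')+\frac1{2\eta}\|y'-y\|^2\}$. The sequence generated by the algorithm satisfies, for all $t\ge1$: $x^{(t)}\in\mathrm{span}\big(\{A^\top b,\bar A^\top\bar b\}\cup\bigcup_{s=0}^{t-1}\{x^{(s)},\nabla f_0(x^{(s)}),A^\top Ax^{(s)},\bar A^\top\bar Ax^{(s)},\bar A^\top y^{(s)}\}\big)$ and $y^{(t)}\in\mathrm{span}(\{\xi^{(t)},\zeta^{(t)}\})$, where $\xi^{(t)}\in\mathrm{span}\big(\{\bar b\}\cup\bigcup_{s=0}^{t-1}\{y^{(s)},\bar A\bar A^\top y^{(s)},\bar Ax^{(s)}\}\big)$ and $\zeta^{(t)}\in\{\mathrm{prox}_{\eta\bar g}(\xi^{(t)}):\eta>0\}$. The point $(x^{(t)},y^{(t)})$ is generated by the $t$-th iteration, and each iteration calls the oracle once. **Condition number.** $[\bar A;A]$ is the vertical stacking; $\kappa(M)=\sqrt{\lambda_{\max}(MM^\top)/\lambda_{\min}(MM^\top)}$,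 where $\lambda_{\max}$ is the largest and $\lambda_{\min}$ the smallest positive eigenvalue. **Instance $\mathcal P$.** Parameters $\epsilon>0$, $L_f>0$; integers $m_1\ge2$ even, $m_2\ge1$, $\bar d\ge5$ odd. Put $m=3m_1m_2$, $d=m\bar d$, $\mathcal M=\{im_1:i=1,\dots,3m_2-1\}$, $\mathcal M^C=\{1,\dots,m-1\}\setminus\mathcal M$, $n=(m-3m_2)\bar d$, $\bar n=(3m_2-1)\bar d$. Write $x=(x_1^\top,\dots,x_m^\top)^\top\in\mathbb R^d$, $x_i\in\mathbb R^{\bar d}$. $J_m\in\mathbb R^{(m-1)\times m}$ has $(J_m)_{i,i}=-1$, $(J_m)_{i,i+1}=1$, other entries $0$; $J_{\mathcal M},J_{\mathcal M^C}$ are its rows indexed by $\mathcal M,\mathcal M^C$. $\bar A=mL_fJ_{\mathcal M}\otimes I_{\bar d}$, $A=mL_fJ_{\mathcal M^C}\otimes I_{\bar d}$, $b=0$, $\bar b=0$. $\bar g(y)=\frac{\beta}{mL_f}\|y\|_1$, $g(x)=\bar g(\bar Ax)=\beta\sum_{i\in\mathcal M}\|x_i-x_{i+1}\|_1$, with $\beta$ a constant satisfying $\beta>(50\pi+1+\|A\|)\sqrt m\,\epsilon$. $\Psi(u)=0$ for $u\le0$, $\Psi(u)=1-e^{-u^2}$ for $u>0$; $\Phi(v)=4\arctan v+2\pi$. For $z\in\mathbb R^{\bar d}$: $\varphi(z,1)=-\Psi(1)\Phi([z]_1)$; $\varphi(z,j)=\Psi(-[z]_{j-1})\Phi(-[z]_j)-\Psi([z]_{j-1})\Phi([z]_j)$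 for $j=2,\dots,\bar d$, where $[z]_j$ is the $j$-th coordinate. $h_i(z)=\varphi(z,1)+3\sum_{j=1}^{\lfloor\bar d/2\rfloor}\varphi(z,2j)$ for $1\le i\le\frac m3$; $h_i(z)=\varphi(z,1)$ for $\frac m3+1\le i\le\frac{2m}3$; $h_i(z)=\varphi(z,1)+3\sum_{j=1}^{\lfloor\bar d/2\rfloor}\varphi(z,2j+1)$ for $\frac{2m}3+1\le i\le m$. $f_i(z)=\frac{300\pi\epsilon^2}{mL_f}h_i\big(\frac{\sqrt mL_fz}{150\pi\epsilon}\big)$ and $f_0(x)=\sum_{i=1}^mf_i(x_i)$. **Convention on the starting point.** The starting point $(x^{(0)},y^{(0)})$ is arbitrary. The instance is written for $(x^{(0)},y^{(0)})=(0,0)$, which is assumed without loss of generality; otherwise the instance is translated by the corresponding change of variables ($x$ replaced by $x-x^{(0)}$ in $f_0$, $g$ and the constraint).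
   Formalization: For a nonzero starting point, Assumption 3 is imposed on the displacements x^(t)-x^(0), y^(t)-y^(0) with respect to the untranslated instance; taken literally on the translated instance the claim fails (e.g. x^(1)=2x^(0) may be stationary). For the start (0,0) nothing changes. *)

(* Defs.v *)
From HB Require Import structures.
From mathcomp Require Import all_boot all_order all_algebra.
From mathcomp Require Import mxtens.
From mathcomp Require Import all_classical all_reals all_analysis.

Set Implicit Arguments.
Unset Strict Implicit.
Unset Printing Implicit Defensive.

Import Order.TTheory GRing.Theory Num.Theory numFieldNormedType.Exports.

Local Open Scope classical_set_scope.
Local Open Scope ring_scope.

Section Euclidean.
Context {R : realType}.

Definition dot (n : nat) (u v : 'cV[R]_n) : R := \sum_(i < n) u i 0 * v i 0.

(* The norm `|v| of the library on matrices is the max norm. *)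
Definition norm2 (n : nat) (v : 'cV[R]_n) : R := Num.sqrt (\sum_(i < n) v i 0 ^+ 2).

Definition norm1 (n : nat) (v : 'cV[R]_n) : R := \sum_(i < n) `|v i 0|.

Definition opnorm (m n : nat) (M : 'M[R]_(m, n)) : R :=
  sup [set norm2 (M *m v) | v in [set v : 'cV[R]_n | norm2 v <= 1]].

Definition kappa (m n : nat) (M : 'M[R]_(m, n)) : R :=
  Num.sqrt (sup [set a : R | eigenvalue (M *m M^T) a] /
            inf [set a : R | 0 < a /\ eigenvalue (M *m M^T) a]).

Definition grad (n : nat) (f : 'cV[R]_n -> R) (x : 'cV[R]_n) : 'cV[R]_n :=
  \col_(i < n) 'D_(delta_mx i 0) f x.

(* dist(0, S), equal to +oo when S is empty. *)
Definition dist0 (n : nat) (S : set 'cV[R]_n) : \bar R :=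
  ereal_inf [set (norm2 v)%:E | v in S].

Definition proper (n : nat) (g : 'cV[R]_n -> \bar R) : Prop :=
  (forall x, g x != -oo%E) /\ (exists x, g x \is a fin_num).

Definition convex (n : nat) (g : 'cV[R]_n -> \bar R) : Prop :=
  forall (x y : 'cV[R]_n) (s : R), 0 <= s <= 1 ->
    (g (s *: x + (1 - s) *: y)%R <= s%:E * g x + (1 - s)%:E * g y)%E.

Definition proper_lsc_convex (n : nat) (g : 'cV[R]_n -> \bar R) : Prop :=
  [/\ proper g, lower_semicontinuous g & convex g].

Definition subdiff (n : nat) (g : 'cV[R]_n -> \bar R) (x : 'cV[R]_n) :
    set 'cV[R]_n :=
  [set v | g x \is a fin_num /\
           forall z, (g x + (dot v (z - x))%:E <= g z)%E].

(* z = prox_{eta g}(y) *)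
Definition is_prox (n : nat) (g : 'cV[R]_n -> \bar R) (eta : R)
    (y z : 'cV[R]_n) : Prop :=
  forall z', (g z + ((2 * eta)^-1 * norm2 (z - y) ^+ 2)%:E <=
              g z' + ((2 * eta)^-1 * norm2 (z' - y) ^+ 2)%:E)%E.

End Euclidean.

(* min f0 x + g x  s.t.  A x + b = 0,  where  g x = gbar (Abar x + bbar). *)
Record problem (R : realType) (d n nbar : nat) := Problem {
  f0 : 'cV[R]_d -> R;
  gbar : 'cV[R]_nbar -> \bar R;
  mxA : 'M[R]_(n, d);
  vecb : 'cV[R]_n;
  mxAbar : 'M[R]_(nbar, d);
  vecbbar : 'cV[R]_nbar
}.

Section Problem.
Context {R : realType} {d n nbar : nat}.
Implicit Type P : problem R d n nbar.

Definition g P (x : 'cV[R]_d) : \bar R := gbar P (mxAbar P *m x + vecbbar P).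

Definition F0 P (x : 'cV[R]_d) : \bar R := ((f0 P x)%:E + g P x)%E.

Definition infF0 P : \bar R := ereal_inf (range (F0 P)).

Definition assumption1 (Lf : R) P : Prop :=
  [/\ forall x, differentiable (f0 P) x,
      forall x y, norm2 (grad (f0 P) x - grad (f0 P) y) <= Lf * norm2 (x - y),
      (-oo < infF0 P)%E,
      proper_lsc_convex (g P)
    & proper_lsc_convex (gbar P)].

Definition stationary (eps : R) P (x : 'cV[R]_d) : Prop :=
  exists gamma : 'cV[R]_n,
    (maxe (dist0 [set (grad (f0 P) x + (mxA P)^T *m gamma + v)%R
                 | v in subdiff (g P) x])
          (norm2 (mxA P *m x + vecb P))%:E <= eps%:E)%E.

Definition near_stationary (omega eps : R) P (x : 'cV[R]_d) : Prop :=
  exists xs, stationary eps P xs /\ norm2 (x - xs) <= omega.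

Definition linear_span P (x : nat -> 'cV[R]_d) (y : nat -> 'cV[R]_nbar) : Prop :=
  let A := mxA P in let b := vecb P in
  let Abar := mxAbar P in let bbar := vecbbar P in
  forall t : nat, (1 <= t)%N ->
    (x t \in <<[:: A^T *m b; Abar^T *m bbar] ++
               flatten [seq [:: x s; grad (f0 P) (x s); A^T *m (A *m x s);
                                Abar^T *m (Abar *m x s); Abar^T *m y s]
                       | s <- iota 0 t]>>%VS) /\
    exists xi zeta : 'cV[R]_nbar,
      [/\ xi \in <<bbar :: flatten [seq [:: y s; Abar *m (Abar^T *m y s);
                                            Abar *m x s] | s <- iota 0 t]>>%VS,
          exists2 eta, 0 < eta & is_prox (gbar P) eta xi zeta
        & y t \in <<[:: xi; zeta]>>%VS].

(* The change of variables x ~> x - x0 in f0, g and the constraint. *)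
Definition translate (x0 : 'cV[R]_d) P : problem R d n nbar :=
  {| f0 := fun x => f0 P (x - x0);
     gbar := gbar P;
     mxA := mxA P;
     vecb := vecb P - mxA P *m x0;
     mxAbar := mxAbar P;
     vecbbar := vecbbar P - mxAbar P *m x0 |}.

Definition Delta P (x0 : 'cV[R]_d) : R := fine (F0 P x0 - infF0 P).

End Problem.

(* In this section the coordinates [z]_j, the functions h_i, f_i and the rows
   of J_m are numbered from 1 as on paper, whereas ordinals start at 0. *)
Section Instance.
Context {R : realType}.
Variables (eps Lf : R) (m1 m2 dbar : nat) (beta : R).

Definition Psi (u : R) : R := if u <= 0 then 0 else 1 - expR (- u ^+ 2).
Definition Phi (v : R) : R := 4 * atan v + 2 * pi.

Definition coord (z : 'cV[R]_dbar) (j : nat) : R :=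
  \sum_(k < dbar | k.+1 == j) z k 0.

Definition varphi (z : 'cV[R]_dbar) (j : nat) : R :=
  if j == 1%N then - Psi 1 * Phi (coord z 1)
  else Psi (- coord z j.-1) * Phi (- coord z j)
       - Psi (coord z j.-1) * Phi (coord z j).

Definition dim_m : nat := (3 * m1 * m2)%N.

Definition h (i : nat) (z : 'cV[R]_dbar) : R :=
  if (i <= dim_m %/ 3)%N then
    varphi z 1 + 3 * \sum_(1 <= j < (dbar./2).+1) varphi z (2 * j)
  else if (i <= 2 * dim_m %/ 3)%N then varphi z 1
  else varphi z 1 + 3 * \sum_(1 <= j < (dbar./2).+1) varphi z (2 * j + 1).

Definition f (i : nat) (z : 'cV[R]_dbar) : R :=
  300 * pi * eps ^+ 2 / (dim_m%:R * Lf) *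
  h i ((Num.sqrt dim_m%:R * Lf / (150 * pi * eps)) *: z).

Definition block (x : 'cV[R]_(dim_m * dbar)) (i : 'I_dim_m) : 'cV[R]_dbar :=
  \col_(j < dbar) x (mxtens_index (i, j)) 0.

Definition f0_inst (x : 'cV[R]_(dim_m * dbar)) : R :=
  \sum_(i < dim_m) f i.+1 (block x i).

Definition J : 'M[R]_(dim_m.-1, dim_m) :=
  \matrix_(i, j) (if j == i :> nat then -1 else if j == i.+1 :> nat then 1 else 0).

Definition calM : {set 'I_dim_m.-1} :=
  [set k : 'I_dim_m.-1 | k.+1 \in [seq (i * m1)%N | i <- iota 1 (3 * m2 - 1)]].
Definition calMC : {set 'I_dim_m.-1} := (~: calM)%SET.

(* enum_val lists the rows in increasing order; the row counts #|calM| and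
   #|calMC| are 3 m2 - 1 and m - 3 m2, see card_calM and card_calMC. *)
Definition Abar_inst : 'M[R]_(#|calM| * dbar, dim_m * dbar) :=
  (dim_m%:R * Lf) *: (rowsub (@enum_val _ (mem calM)) J *t 1%:M).
Definition A_inst : 'M[R]_(#|calMC| * dbar, dim_m * dbar) :=
  (dim_m%:R * Lf) *: (rowsub (@enum_val _ (mem calMC)) J *t 1%:M).

Definition gbar_inst (y : 'cV[R]_(#|calM| * dbar)) : \bar R :=
  (beta / (dim_m%:R * Lf) * norm1 y)%:E.

Definition inst : problem R (dim_m * dbar) (#|calMC| * dbar) (#|calM| * dbar) :=
  {| f0 := f0_inst; gbar := gbar_inst; mxA := A_inst; vecb := 0;
     mxAbar := Abar_inst; vecbbar := 0 |}.

End Instance.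

Lemma card_calM (m1 m2 : nat) : (0 < m1)%N -> (0 < m2)%N ->
  #|calM m1 m2| = (3 * m2 - 1)%N.
Proof.
move=> m1_gt0 m2_gt0.
have mE : dim_m m1 m2 = (m1 * (3 * m2 - 1).+1)%N.
  by rewrite subn1 prednK ?muln_gt0 // /dim_m mulnAC mulnC.
pose s := [seq (i * m1)%N | i <- iota 1 (3 * m2 - 1)].
have s_uniq : uniq s.
  by rewrite map_inj_uniq ?iota_uniq // => i j /eqP; rewrite eqn_pmul2r // => /eqP.
have := size_map (muln ^~ m1) (iota 1 (3 * m2 - 1)); rewrite size_iota => <-.
rewrite cardE -(size_map (fun k : 'I_(dim_m m1 m2).-1 => k.+1)).
apply/perm_size/uniq_perm => //.
  by rewrite map_inj_uniq ?enum_uniq // => i j [] /val_inj.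
move=> k; apply/mapP/idP => [[i]|ks]; first by rewrite mem_enum inE => ? ->.
have /mapP[i] := ks; rewrite mem_iota => /andP[i1 im] kE.
have k0 : (0 < k)%N by rewrite kE muln_gt0 i1.
have km : (k.-1 < (dim_m m1 m2).-1)%N.
  rewrite -ltnS !prednK ?mE ?muln_gt0 ?m1_gt0 //.
  by rewrite kE mulnC ltn_pmul2l //; rewrite addnC addn1 in im.
exists (Ordinal km); last by rewrite /= prednK.
by rewrite mem_enum inE /= prednK.
Qed.

Lemma card_calMC (m1 m2 : nat) : (0 < m1)%N -> (0 < m2)%N ->
  #|calMC m1 m2| = (dim_m m1 m2 - 3 * m2)%N.
Proof.
move=> m1_gt0 m2_gt0; have := cardsC (calM m1 m2).
rewrite card_calM // card_ord => /(canRL (addKn _)) ->.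
by rewrite -subn1 -subnDA subnKC // muln_gt0.
Qed.

(* Main.v *)
(* The gradient of f_0 at x creates coordinate j + 1 of a block from coordinate j,
   only in the first third of the blocks if j + 1 is even and only in the last
   third if it is odd, while A, Abar and the separable prox move a nonzero
   coordinate by at most one block per iteration; each new coordinate thus costs
   at least m/3 iterations, and the last one is 0 in every block before
   iteration (dbar - 2) m/3.

   At an eps-stationary point the residual is tested against the vectors equal
   to a unit vector on the blocks after p and to 0 before.  For p in M the large
   beta forces x_p = x_(p+1); feasibility bounds the remaining jumps; and p = 0
   bounds the average of the gradients of the h_i, which is the gradient of the
   usual hard chain function.  The latter exceeds 10/9 as soon as one rescaled
   coordinate has modulus < 1, so all of them have modulus >= 1, and an
   omega-close point has a block whose last coordinate is nonzero.

   Finally kappa <= 2 m (discrete Poincare inequality) and Delta <= 1200 pi^2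
   eps^2 dbar / Lf bound the claimed number of iterations by 2 m dbar / 15. *)
Require Import Defs.
From HB Require Import structures.
From mathcomp Require Import all_boot all_order all_algebra.
From mathcomp Require Import mxtens ring lra zify.
From mathcomp Require Import all_classical all_reals all_analysis.
Import Order.TTheory GRing.Theory Num.Theory numFieldNormedType.Exports.
Set Implicit Arguments.
Unset Strict Implicit.
Unset Printing Implicit Defensive.
Local Open Scope classical_set_scope.
Local Open Scope ring_scope.

(** * The scalar functions Psi and Phi *)

Section Scalar.
Context {R : realType}.
Implicit Types u v : R.

Definition dPsi u : R := if u <= 0 then 0 else 2 * u * expR (- u ^+ 2).
Definition dPhi v : R := 4 / (1 + v ^+ 2).

Lemma expRN_le_inv u : 0 <= u -> expR (- u) <= (1 + u)^-1.
Proof.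
move=> u0; rewrite expRN lef_pV2 ?posrE ?expR_gt0 ?expR_ge1Dx //.
exact: ltr_pwDl.
Qed.

Lemma is_derive_expRNsqr u :
  is_derive u 1 (fun t => expR (- t ^+ 2)) (- (2 * u) * expR (- u ^+ 2)).
Proof.
apply: is_derive_eq.
by rewrite /GRing.scale /=; ring.
Qed.

Lemma is_derive_Psi u : is_derive u 1 (@Psi R) (dPsi u).
Proof.
rewrite /dPsi; case: (ltgtP u 0) => [u0|u0|->].
- apply: (@near_eq_is_derive _ _ _ (cst 0)).
  near=> t; rewrite /Psi ifT //; near: t; exact: lt_le_nbhsl.
- have dE := is_derive_expRNsqr u.
  have d1E : is_derive u 1 (fun t => 1 - expR (- t ^+ 2))
      (2 * u * expR (- u ^+ 2)).
    by apply: is_derive_eq; ring.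
  apply: near_eq_is_derive d1E.
  near=> t; rewrite /Psi ifF //; apply/negbTE; rewrite -ltNge; near: t.
  exact: lt_nbhsr.
(* At the junction 0 the difference quotient vanishes on the left and is at most h^2 / h = h on the
   right, because exp (-h^2) >= 1 - h^2. *)
- have H : (fun h => h^-1 *: (Psi (h *: 1 + 0) - Psi 0)) @ 0^' --> (0 : R).
    apply/cvgrPdist_le => e e0; near=> h.
    rewrite sub0r normrN [_%:A]mulr1 addr0 /Psi lexx subr0.
    case: ifP => h0; first by rewrite scaler0 normr0 ltW.
    have {}h0 : 0 < h by rewrite ltNge h0.
    have h1 : expR (- h ^+ 2) >= 1 - h ^+ 2 by exact: expR_ge1Dx.
    have h2 : expR (- h ^+ 2) <= 1 by rewrite expR_le1 oppr_le0 sqr_ge0.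
    have he : h <= e.
      apply: le_trans (ler_norm _) _; near: h.
      apply: dnbhs0_le => //.
    rewrite /GRing.scale /= ger0_norm; last first.
      by rewrite mulr_ge0 ?subr_ge0 // invr_ge0 ltW.
    rewrite mulrC ler_pdivrMr //; apply: le_trans (_ : h ^+ 2 <= _).
      by rewrite lerBlDr -lerBlDl.
    by rewrite expr2 ler_pM2r.
  by apply: DeriveDef; [apply/cvg_ex; exists 0 | apply/cvg_lim].
Unshelve. all: by end_near. Qed.

Lemma is_derive_Phi v : is_derive v 1 (@Phi R) (dPhi v).
Proof.
rewrite /Phi /dPhi.
apply: is_derive_eq.
by rewrite /GRing.scale /=; ring.
Qed.

Lemma lipschitz_of_derive (F dF : R -> R) (K : R) :
  (forall t : R, is_derive t 1 F (dF t)) -> (forall t, `|dF t| <= K) ->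
  forall s t, `|F s - F t| <= K * `|s - t|.
Proof.
move=> FdF bdF s t; wlog st : s t / s <= t.
  move=> H; have [|/ltW] := leP s t; first exact: H.
  by move=> /H; rewrite distrC (distrC t).
have [|c _] := @MVT_segment R F dF s t st (fun x _ => FdF x).
  apply: continuous_subspaceT => x; apply/differentiable_continuous.
  by rewrite -derivable1_diffP; case: (FdF x).
by rewrite distrC (distrC s) => ->; rewrite normrM ler_wpM2r.
Qed.

Lemma Psi_le0 u : u <= 0 -> Psi u = 0.
Proof. by rewrite /Psi => ->. Qed.

Lemma Psi_ge0 u : 0 <= Psi u.
Proof.
by rewrite /Psi; case: ifP => // _; rewrite subr_ge0 expR_le1 oppr_le0 sqr_ge0.
Qed.

Lemma Psi_le1 u : Psi u <= 1.
Proof. by rewrite /Psi; case: ifP => // _; rewrite gerBl expR_ge0. Qed.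

Lemma Psi_ge u : 1 <= u -> 5 / 9 <= Psi u.
Proof.
move=> u1; rewrite /Psi ifF; last by apply/negbTE; rewrite -ltNge; lra.
(* e >= (1 + 1/2)^2 = 9/4, so 1 - exp (-1) >= 5/9. *)
have e1 : 9 / 4 <= expR (1 : R).
  have := expRD (2^-1 : R) 2^-1; rewrite (_ : 2^-1 + 2^-1 = 1); last by lra.
  move=> ->.
  have : 3 / 2 <= expR (2^-1 : R) by apply: le_trans (expR_ge1Dx _); lra.
  by nra.
have : expR (- u ^+ 2) <= expR (- 1) by rewrite ler_expR; nra.
suff : expR (- 1 : R) <= 4 / 9 by lra.
by rewrite expRN -[4 / 9]invf_div lef_pV2 ?posrE ?expR_gt0 //; lra.
Qed.

Lemma dPsi_le0 u : u <= 0 -> dPsi u = 0.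
Proof. by rewrite /dPsi => ->. Qed.

Lemma dPsi_ge0 u : 0 <= dPsi u.
Proof.
by rewrite /dPsi; case: (lerP u 0) => // /ltW u0; rewrite !mulr_ge0 ?expR_ge0.
Qed.

(** exp (-u^2) <= 1 / (1 + u^2), and 2 u <= 1 + u^2. *)
Lemma dPsi_le1 u : dPsi u <= 1.
Proof.
rewrite /dPsi; case: (lerP u 0) => // u0.
have /expRN_le_inv le := sqr_ge0 u.
apply: le_trans (_ : 2 * u * (1 + u ^+ 2)^-1 <= 1).
  by rewrite ler_pM2l // mulr_gt0.
rewrite ler_pdivrMr ?mul1r; last by apply: ltr_pwDl => //; exact: sqr_ge0.
by have := sqr_ge0 (u - 1); lra.
Qed.

(** [dPsi] is the 1-Lipschitz map t -> max t 0 followed by the smooth function 2 t exp (-t^2), whose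
    derivative has modulus at most 4. *)
Lemma dPsi_lipschitz u v : `|dPsi u - dPsi v| <= 4 * `|u - v|.
Proof.
pose q (t : R) : R := 2 * t * expR (- t ^+ 2).
have dq (t : R) : is_derive t 1 q ((2 - 4 * t ^+ 2) * expR (- t ^+ 2)).
  have H := is_derive_expRNsqr t.
  have H2 : is_derive t 1 (fun s : R => 2 * s) 2.
    by apply: is_derive_eq; rewrite /GRing.scale /=; ring.
  by apply: is_derive_eq; rewrite /GRing.scale /=; ring.

have dPsiE t : dPsi t = q (Num.max t 0).
  by rewrite /dPsi /q; case: (lerP t 0) => //; rewrite mulr0 mul0r.
rewrite !dPsiE; apply: le_trans (lipschitz_of_derive (K := 4) dq _ _ _) _ => [t|].
  have /expRN_le_inv le := sqr_ge0 t.
  rewrite normrM (ger0_norm (expR_ge0 _)).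
  have t0 : 0 <= t ^+ 2 := sqr_ge0 t.
  apply: le_trans (_ : `|2 - 4 * t ^+ 2| * (1 + t ^+ 2)^-1 <= 4).
    exact: ler_wpM2l.
  by rewrite ler_pdivrMr ?ler_norml; [apply/andP; split|]; lra.
rewrite ler_pM2l //.
have a := ler_norm (u - v); have b := ler_norm (v - u); have c := normr_ge0 (u - v).
rewrite distrC in b; rewrite ler_norml.
by case: (lerP u 0) => ?; case: (lerP v 0) => ?; apply/andP; split; lra.
Qed.

Lemma Psi_lipschitz u v : `|Psi u - Psi v| <= `|u - v|.
Proof.
rewrite -[leRHS]mul1r; apply: lipschitz_of_derive (@is_derive_Psi) _ _ _ => t.
by rewrite ger0_norm ?dPsi_ge0 ?dPsi_le1.
Qed.

Lemma Phi_gt0 v : 0 < Phi v.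
Proof. by rewrite /Phi; have := atan_gtNpi2 v; lra. Qed.

Lemma PhiD v : Phi v + Phi (- v) = 4 * pi.
Proof. by rewrite /Phi atanN; ring. Qed.

Lemma Phi_lt v : Phi v < 4 * pi.
Proof. by have := PhiD v; have := Phi_gt0 (- v); lra. Qed.

Lemma dPhiN v : dPhi (- v) = dPhi v.
Proof. by rewrite /dPhi sqrrN. Qed.

Lemma dPhi_gt0 v : 0 < dPhi v.
Proof. by rewrite divr_gt0 // ltr_pwDl ?sqr_ge0. Qed.

Lemma dPhi_le4 v : dPhi v <= 4.
Proof.
have v0 := sqr_ge0 v; rewrite ler_pdivrMr; first by lra.
by rewrite ltr_pwDl.
Qed.

Lemma dPhi_gt2 v : `|v| < 1 -> 2 < dPhi v.
Proof.
rewrite ltr_norml => /andP[v1 v2].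
have : 0 < (1 - v) * (1 + v) by apply: mulr_gt0; lra.
rewrite ltr_pdivlMr => [?|]; first lra.
by rewrite ltr_pwDl ?sqr_ge0.
Qed.

Lemma Phi_lipschitz u v : `|Phi u - Phi v| <= 4 * `|u - v|.
Proof.
apply: lipschitz_of_derive is_derive_Phi _ _ _ => t.
by rewrite gtr0_norm ?dPhi_gt0 ?dPhi_le4.
Qed.

Lemma dPhi_lipschitz u v : `|dPhi u - dPhi v| <= 4 * `|u - v|.
Proof.
have pos t : 0 < 1 + t ^+ 2 :> R by rewrite ltr_pwDl ?sqr_ge0.
have nz t : 1 + t ^+ 2 != 0 :> R by rewrite gt_eqF.
(* With u - v factored out, what remains is |u + v| <= (1 + u^2) (1 + v^2). *)
have -> : dPhi u - dPhi v =
    - (4 * (u + v) / ((1 + u ^+ 2) * (1 + v ^+ 2))) * (u - v).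
  by rewrite /dPhi; field; rewrite !nz.
rewrite normrM normrN ler_wpM2r // normrM normfV ler_pdivrMr; last first.
  by rewrite normr_gt0 mulf_neq0.
rewrite normrM (ger0_norm (_ : 0 <= 4)) // ler_pM2l // (gtr0_norm (mulr_gt0 (pos u) (pos v))).
have := sqr_ge0 (u - 1); have := sqr_ge0 (u + 1).
have := sqr_ge0 (v - 1); have := sqr_ge0 (v + 1).
have := sqr_ge0 u; have := sqr_ge0 v.
have : 0 <= u ^+ 2 * v ^+ 2 by rewrite mulr_ge0 ?sqr_ge0.
by rewrite ler_norml => *; apply/andP; split; lra.
Qed.

End Scalar.

(** * The link function of two consecutive coordinates and its partial derivatives *)

Section Pair.
Context {R : realType}.
Implicit Types u v : R.

(* varphi z j is [pairf] at the coordinates j - 1 and j of z, and also for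
   j = 1 if the coordinate 0 is read as 1, since Psi (- 1) = 0. *)
Definition pairf u v : R := Psi (- u) * Phi (- v) - Psi u * Phi v.
(** [pairf_l] and [pairf_r] are the partial derivatives of [pairf]. In the second one, Psi (-u) +
    Psi u is written as Psi |u|, since one of the two terms is always 0. *)
Definition pairf_l u v : R := - (dPsi (- u) * Phi (- v) + dPsi u * Phi v).
Definition pairf_r u v : R := - (Psi `|u| * dPhi v).

Lemma pairf_ge u v : - (4 * pi) <= pairf u v.
Proof.
have := Psi_le1 u; have := Psi_ge0 u; have := Psi_ge0 (- u).
have := Phi_gt0 v; have := Phi_gt0 (- v); have := Phi_lt v.
by rewrite /pairf; nra.
Qed.

Lemma pairf_0l v : pairf 0 v = 0.
Proof. by rewrite /pairf oppr0 Psi_le0 // !mul0r subr0. Qed.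

Lemma pairf_l0 v : pairf_l 0 v = 0.
Proof. by rewrite /pairf_l oppr0 dPsi_le0 // !mul0r addr0 oppr0. Qed.

Lemma pairf_r0 v : pairf_r 0 v = 0.
Proof. by rewrite /pairf_r normr0 Psi_le0 // mul0r oppr0. Qed.

Lemma Psi_norm u : Psi `|u| = Psi (- u) + Psi u.
Proof.
case: (ger0P u) => [u0|/ltW u0]; last by rewrite (Psi_le0 u0) addr0.
by rewrite (@Psi_le0 _ (- u)) ?add0r // oppr_le0.
Qed.

Lemma pairf_l_le0 u v : pairf_l u v <= 0.
Proof.
by rewrite oppr_le0 addr_ge0 // mulr_ge0 ?dPsi_ge0 // ltW ?Phi_gt0.
Qed.

Lemma pairf_r_le0 u v : pairf_r u v <= 0.
Proof.
by rewrite oppr_le0 mulr_ge0 ?Psi_ge0 // ltW ?dPhi_gt0.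
Qed.

(** Both values of [dPsi] are at most 1, and Phi v + Phi (-v) = 4 pi. *)
Lemma norm_pairf_l u v : `|pairf_l u v| <= 4 * pi.
Proof.
rewrite ler0_norm ?pairf_l_le0 // opprK.
have := dPsi_le1 u; have := dPsi_le1 (- u); have := Phi_gt0 v.
by have := Phi_gt0 (- v); have := PhiD v; nra.
Qed.

Lemma norm_pairf_r u v : `|pairf_r u v| <= 4.
Proof.
rewrite ler0_norm ?pairf_r_le0 // opprK.
have := Psi_le1 `|u|; have := Psi_ge0 `|u|.
by have := dPhi_gt0 v; have := dPhi_le4 v; nra.
Qed.

(** Psi |u| >= 5/9 and [dPhi v] > 2 multiply to 10/9. This is the large gradient entry of the hard
    chain. *)
Lemma pairf_r_lt u v : 1 <= `|u| -> `|v| < 1 -> pairf_r u v < - (10 / 9).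
Proof. by rewrite /pairf_r => /Psi_ge u1 /dPhi_gt2 v1; nra. Qed.

Lemma norm_mulB_le (a b a' b' A B r s : R) : 0 <= b -> 0 <= a' <= B ->
  `|a - a'| <= r -> `|b - b'| <= s -> b <= A ->
  `|a * b - a' * b'| <= r * A + B * s.
Proof.
move=> b0 /andP[a0 a'B] aa bb bA.
have -> : a * b - a' * b' = (a - a') * b + a' * (b - b') by ring.
apply: le_trans (ler_normD _ _) _.
rewrite !normrM (ger0_norm b0) (ger0_norm a0).
by apply: lerD; apply: ler_pM.
Qed.

Lemma pairf_l_lipschitz u v u' v' :
  `|pairf_l u v - pairf_l u' v'| <= 16 * pi * `|u - u'| + 8 * `|v - v'|.
Proof.
have aux (s t s' t' : R) : `|dPsi s * Phi t - dPsi s' * Phi t'| <=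
    4 * `|s - s'| * Phi t + 1 * (4 * `|t - t'|).
  apply: norm_mulB_le; rewrite ?dPsi_ge0 ?dPsi_le1 ?dPsi_lipschitz
    ?Phi_lipschitz //; exact/ltW/Phi_gt0.
rewrite /pairf_l -opprD normrN opprD addrACA.
apply: le_trans (ler_normD _ _) _; have := aux u v u' v'.
have := aux (- u) (- v) (- u') (- v'); rewrite -!opprD !normrN.
(* The two factors [Phi] add up to 4 pi, so the constant is 4 * 4 pi and not twice that. *)
have -> : Phi (- v) = 4 * pi - Phi v by rewrite -(PhiD v); ring.
by lra.
Qed.

Lemma pairf_r_lipschitz u v u' v' :
  `|pairf_r u v - pairf_r u' v'| <= 4 * `|u - u'| + 4 * `|v - v'|.
Proof.
rewrite /pairf_r -opprD normrN [4 * `|u - u'|]mulrC -[4 * `|v - v'|]mul1r.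
apply: norm_mulB_le; rewrite ?Psi_ge0 ?Psi_le1 ?dPhi_lipschitz ?dPhi_le4 //.
  exact/ltW/dPhi_gt0.
by apply: le_trans (Psi_lipschitz _ _) _; exact: ler_dist_dist.
Qed.

End Pair.

(** * Differentials of coordinates, sums and compositions *)

Section Differential.
Context {R : realType}.

Lemma is_diff_scalar (F dF : R -> R) (t : R) :
  is_derive t 1 F (dF t) -> is_diff t F (fun h => h * dF t).
Proof.
move=> FdF; have dft : differentiable F t by rewrite -derivable1_diffP; case: FdF.
apply: DiffDef => //; rewrite diff1E //; apply/funext => h.
by rewrite derive1E derive_val.
Qed.

Lemma is_diff_coord m n (M : 'M[R]_(m, n)) i j :
  is_diff M (fun N : 'M[R]_(m, n) => N i j : R) (fun N => N i j).
Proof.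
have @f : {linear 'M[R]_(m, n) -> R}.
  by exists (fun N : 'M[R]_(_, _) => N i j); do 2![eexists]; do ?[constructor];
     rewrite ?mxE// => ? *; rewrite ?mxE//; move=> ?; rewrite !mxE.
rewrite (_ : (fun _ => _) = f) //; apply: DiffDef; last first.
  by rewrite diff_lin //; exact: coord_continuous.
exact/linear_differentiable/coord_continuous.
Qed.

Context {V : normedModType R}.
Implicit Types x : V.

Lemma is_diff_sum (I : Type) (r : seq I) (P : pred I) (F dF : I -> V -> R) x :
  (forall i, P i -> is_diff x (F i) (dF i)) ->
  is_diff x (fun y => \sum_(i <- r | P i) F i y)
    (fun v => \sum_(i <- r | P i) dF i v).
Proof.
move=> dFi; elim: r => [|i r IH].
  have E (H : I -> V -> R) : (fun y => \sum_(i <- [::] | P i) H i y) = 0.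
    by apply/funext => y; rewrite big_nil.
  by rewrite !E; exact: is_diff_cst.
have E (H : I -> V -> R) : (fun y => \sum_(j <- i :: r | P j) H j y) =
    if P i then H i + (fun y => \sum_(j <- r | P j) H j y)
    else fun y => \sum_(j <- r | P j) H j y.
  by apply/funext => y; rewrite big_cons; case: ifP.
by rewrite !E; case: (boolP (P i)) => // Pi; exact: is_diffD (dFi _ Pi) IH.
Qed.

Lemma is_diff_chain (F dF : R -> R) (a da : V -> R) x :
  (forall t : R, is_derive t 1 F (dF t)) -> is_diff x a da ->
  is_diff x (fun y => F (a y)) (fun v => da v * dF (a x)).
Proof. by move=> FdF dax; apply: (is_diff_comp dax (is_diff_scalar (FdF _))). Qed.

Lemma is_diffZl (c : R) (a da : V -> R) x : is_diff x a da ->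
  is_diff x (fun y => c * a y) (fun v => c * da v).
Proof. by move=> H; exact: (is_diffZ c H). Qed.

Lemma is_diffMf (a da b db : V -> R) x : is_diff x a da -> is_diff x b db ->
  is_diff x (fun y => a y * b y) (fun v => a x * db v + b x * da v).
Proof. by move=> da' db'; exact: (is_diffM da' db'). Qed.

Lemma is_diff_pairf (a da b db : V -> R) x :
  is_diff x a da -> is_diff x b db ->
  is_diff x (fun y => pairf (a y) (b y))
    (fun v => pairf_l (a x) (b x) * da v + pairf_r (a x) (b x) * db v).
Proof.
move=> dax dbx; have dNa := is_diffN dax; have dNb := is_diffN dbx.
have d1 := is_diffMf (is_diff_chain is_derive_Psi dNa)
  (is_diff_chain is_derive_Phi dNb).
have d2 := is_diffMf (is_diff_chain is_derive_Psi dax)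
  (is_diff_chain is_derive_Phi dbx).
apply: is_diff_eq (is_diffB d1 d2) _; apply/funext => v.
rewrite !fctE /= /pairf_l /pairf_r dPhiN Psi_norm; ring.
Qed.

End Differential.

(** * Sums and block vectors *)

Section SumInequalities.
Context {R : realFieldType}.

(** Cauchy-Schwarz against the indicator of [P], the number of terms being bounded by n; after
    extension by 0 outside [P] it goes by induction on n. *)
Lemma sqr_sum_le (n : nat) (P : pred 'I_n) (a : 'I_n -> R) :
  (\sum_(i | P i) a i) ^+ 2 <= n%:R * \sum_i a i ^+ 2.
Proof.
rewrite big_mkcond; set b := fun i => if P i then a i else 0.
rewrite -/(\sum_i b i).
apply: (@le_trans _ _ (n%:R * \sum_i b i ^+ 2)); last first.
  rewrite ler_wpM2l // ler_sum // => i _; rewrite /b; case: ifP => // _.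
  by rewrite expr0n sqr_ge0.
move: b; clear; elim: n => [|n IH] b; first by rewrite !big_ord0 expr0n mul0r.
rewrite !big_ord_recl; set S := \sum_(i < n) _; set Q := \sum_(i < n) _.
have SQ : S ^+ 2 <= n%:R * Q by exact: IH.
rewrite -natr1; move: (b ord0) => x; have := sqr_ge0 x.
have : 0 <= Q by rewrite sumr_ge0 // => i _; exact: sqr_ge0.
have [n0|n_gt0] := posnP n.
  move: SQ; rewrite n0 mul0r => S0; have -> : S = 0.
    by apply/eqP; rewrite -sqrf_eq0 eq_le S0 sqr_ge0.
  by move=> *; lra.
have {n_gt0} : 0 < n%:R :> R by rewrite ltr0n.
move: SQ; generalize (n%:R : R) => N SQ N0 Q0 x0.
have : 0 <= (S - N * x) ^+ 2 / N by rewrite divr_ge0 ?sqr_ge0 // ltW.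
have -> : (S - N * x) ^+ 2 / N = S ^+ 2 / N - 2 * S * x + N * x ^+ 2.
  by field; rewrite gt_eqF.
have : S ^+ 2 / N <= Q by rewrite ler_pdivrMr // mulrC.
by lra.
Qed.

(** A tridiagonal matrix with constant diagonals a, b, c has operator norm at most a + b + c.
    Convexity of the square with weights a, b, c reduces this to sums of shifted squares, and the
    vanishing boundary values bound each shifted sum by the central one. *)
Lemma band_sum_le (n : nat) (a b c : R) (e : nat -> R) :
  0 <= a -> 0 <= b -> 0 <= c -> e 0%N = 0 -> e n.+1 = 0 ->
  \sum_(k < n) (a * e k + b * e k.+1 + c * e k.+2) ^+ 2 <=
  (a + b + c) ^+ 2 * \sum_(k < n) e k.+1 ^+ 2.
Proof.
move=> a0 b0 c0 e0 en.
pose S := \sum_(k < n) e k.+1 ^+ 2.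
have S1 : \sum_(k < n) e k ^+ 2 <= S.
  have : \sum_(k < n.+1) e k ^+ 2 = S.
    by rewrite big_ord_recl /= e0 expr0n add0r.
  by rewrite big_ord_recr /= => <-; rewrite lerDl sqr_ge0.
have S2 : \sum_(k < n) e k.+2 ^+ 2 <= S.
  have : \sum_(k < n.+1) e k.+1 ^+ 2 = S.
    by rewrite big_ord_recr /= en expr0n addr0.
  by rewrite big_ord_recl /= => <-; rewrite lerDr sqr_ge0.
apply: (@le_trans _ _ (\sum_(k < n) (a + b + c) *
    (a * e k ^+ 2 + b * e k.+1 ^+ 2 + c * e k.+2 ^+ 2))).
  apply: ler_sum => k _; move: (e k) (e k.+1) (e k.+2) => x y z.
  have : 0 <= a * b * (x - y) ^+ 2 := mulr_ge0 (mulr_ge0 a0 b0) (sqr_ge0 _).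
  have : 0 <= b * c * (y - z) ^+ 2 := mulr_ge0 (mulr_ge0 b0 c0) (sqr_ge0 _).
  have : 0 <= a * c * (x - z) ^+ 2 := mulr_ge0 (mulr_ge0 a0 c0) (sqr_ge0 _).
  by lra.
rewrite -mulr_sumr expr2 -mulrA ler_wpM2l ?addr_ge0 ?mulr_ge0 //.
rewrite !big_split /= -!mulr_sumr -/S.
have := ler_wpM2l a0 S1; have := ler_wpM2l c0 S2; lra.
Qed.

End SumInequalities.

Section Blocks.
Context {R : realType} (p q : nat).
Implicit Types x : 'cV[R]_(p * q).

Definition ent x (i : 'I_p) (l : 'I_q) : R := x (mxtens_index (i, l)) 0.

Lemma sum_mxtens (F : 'I_(p * q) -> R) :
  \sum_k F k = \sum_(i < p) \sum_(l < q) F (mxtens_index (i, l)).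
Proof.
rewrite pair_big /= (reindex (@mxtens_index p q)) /=; last first.
  by exists (@mxtens_unindex p q) => k _; rewrite ?mxtens_indexK ?mxtens_unindexK.
by apply: eq_bigr => -[i l].
Qed.

Lemma entP x y : (forall i l, ent x i l = ent y i l) -> x = y.
Proof.
move=> xy; apply/matrixP => k z; rewrite (ord1 z).
by case: (mxtens_indexP k) => i l; exact: xy.
Qed.

Lemma sqr_norm2 n (x : 'cV[R]_n) : norm2 x ^+ 2 = \sum_k x k 0 ^+ 2.
Proof. by rewrite sqr_sqrtr // sumr_ge0 // => i _; exact: sqr_ge0. Qed.

Lemma norm2_ge0 n (x : 'cV[R]_n) : 0 <= norm2 x.
Proof. exact: sqrtr_ge0. Qed.

Lemma sqr_norm2_ent x : norm2 x ^+ 2 = \sum_i \sum_l ent x i l ^+ 2.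
Proof. by rewrite sqr_norm2 sum_mxtens. Qed.

Lemma norm1_ent x : norm1 x = \sum_i \sum_l `|ent x i l|.
Proof. by rewrite /norm1 sum_mxtens. Qed.

Lemma dot_ent x y : dot x y = \sum_i \sum_l ent x i l * ent y i l.
Proof. by rewrite /dot sum_mxtens. Qed.

Lemma entD x y i l : ent (x + y) i l = ent x i l + ent y i l.
Proof. by rewrite /ent mxE. Qed.

Lemma entN x i l : ent (- x) i l = - ent x i l.
Proof. by rewrite /ent mxE. Qed.

Lemma entB x y i l : ent (x - y) i l = ent x i l - ent y i l.
Proof. by rewrite entD entN. Qed.

Lemma ent0 i l : ent 0 i l = 0.
Proof. by rewrite /ent mxE. Qed.

Lemma entZ c x i l : ent (c *: x) i l = c * ent x i l.
Proof. by rewrite /ent mxE. Qed.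

End Blocks.

Lemma ent_tens1 (R : realType) (p p' q : nat) (M : 'M[R]_(p', p))
    (x : 'cV[R]_(p * q)) i l :
  ent ((M *t (1%:M : 'M[R]_q)) *m x) i l = \sum_k M i k * ent x k l.
Proof.
rewrite /ent mxE sum_mxtens; apply: eq_bigr => k _.
rewrite (bigD1 l) //= big1 ?addr0 => [|l' ll']; rewrite tensmxE mxE.
  by rewrite eqxx mulr1.
by rewrite eq_sym (negbTE ll') mulr0 mul0r.
Qed.

(** * The smooth part of the instance *)

Section Weights.
Context {R : realType} (m1 m2 dbar : nat).
Notation m := (dim_m m1 m2).
Notation D := (m1 * m2)%N.

Lemma dim_mE : m = (3 * D)%N. Proof. by rewrite /dim_m mulnA. Qed.

(* Coordinates and blocks are numbered from 1. *)
Definition weight (i j : nat) : R :=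
  if j == 1%N then 1
  else if (i <= D)%N && ~~ odd j || (2 * D < i)%N && odd j then 3 else 0.

Lemma weight_ge0 i j : 0 <= weight i j.
Proof. by rewrite /weight; case: ifP => // _; case: ifP. Qed.

Lemma weight_le3 i j : weight i j <= 3.
Proof. by rewrite /weight; case: ifP => _; [lra | case: ifP => // _; lra]. Qed.

(** For j <> 1 the weight is 3 on exactly one third of the blocks and 0 elsewhere. Averaging over
    the blocks thus gives every link weight 1, which is the usual hard chain function. *)
Lemma sum_weight j : \sum_(i < m) weight i.+1 j = m%:R.
Proof.
rewrite -(big_mkord xpredT (fun i => weight i.+1 j)) dim_mE.
have [->|j1] := eqVneq j 1%N.
  by under eq_bigr do rewrite /weight eqxx; rewrite sumr_const_nat subn0.
rewrite (@big_cat_nat _ _ _ D) /=; [|lia|lia].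
rewrite [X in _ + X](@big_cat_nat _ _ _ (2 * D)) /=; [|lia|lia].
have E (a b : nat) (c : R) : (forall i, (a <= i < b)%N -> weight i.+1 j = c) ->
    \sum_(a <= i < b) weight i.+1 j = c * (b - a)%N%:R.
  move=> H; rewrite (eq_big_nat _ _ H) sumr_const_nat mulr_natr //.
rewrite (E _ _ (if odd j then 0 else 3)) => [|i iD]; last first.
  by rewrite /weight (negbTE j1); case: (odd j); case: ifP => //; lia.
rewrite (E _ _ 0) => [|i iD]; last first.
  by rewrite /weight (negbTE j1); case: (odd j); case: ifP => //; lia.
rewrite (E _ _ (if odd j then 3 else 0)) => [|i iD]; last first.
  by rewrite /weight (negbTE j1); case: (odd j); case: ifP => //; lia.
rewrite subn0 (_ : (3 * D - 2 * D)%N = D); last lia.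
by rewrite natrM; case: (odd j); ring.
Qed.

(** The constant 1 in position 0 makes the first link an instance of [pairf]; positions beyond
    [dbar] hold 0. Both ends therefore have zero increments. *)
Definition xcoord (z : 'cV[R]_dbar) (j : nat) : R :=
  if j == 0%N then 1 else Defs.coord z j.

Lemma xcoordS z (k : 'I_dbar) : xcoord z k.+1 = z k 0.
Proof.
by rewrite /xcoord /= /Defs.coord (big_pred1 k) // => i /=; rewrite eqSS.
Qed.

Lemma xcoord_out z j : (dbar < j)%N -> xcoord z j = 0.
Proof.
case: j => // j dj; rewrite /xcoord /= /Defs.coord big_pred0 // => i.
by rewrite eqSS; apply/negbTE; have := ltn_ord i; lia.
Qed.

Lemma varphiE z j : varphi z j.+1 = pairf (xcoord z j) (xcoord z j.+1).
Proof.
rewrite /varphi /pairf /xcoord eqSS /=; case: eqP => [->|_] //.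
by rewrite [Psi (- 1)]Psi_le0 ?mul0r ?sub0r ?mulNr // lerN10.
Qed.

(** As [dbar] is odd, its coordinates are 1 and the pairs 2j, 2j + 1 with 1 <= j <= dbar/2, exactly
    those summed in [h]. *)
Lemma hE i (z : 'cV[R]_dbar) : odd dbar ->
  h m1 m2 i z = \sum_(j < dbar) weight i j.+1 * varphi z j.+1.
Proof.
move=> dodd; rewrite -(big_mkord xpredT (fun j => weight i j.+1 * varphi z j.+1)).
have {}dodd : dbar = (dbar./2).*2.+1 by rewrite -[LHS]odd_double_half dodd.
have E q : \sum_(0 <= j < q.*2.+1) weight i j.+1 * varphi z j.+1 =
    varphi z 1 + \sum_(1 <= j < q.+1) (weight i (2 * j) * varphi z (2 * j) +
      weight i (2 * j + 1) * varphi z (2 * j + 1)).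
  elim: q => [|q IH].
    by rewrite big_nat1 big_geq // /weight eqxx mul1r addr0.
  rewrite doubleS big_nat_recr //= big_nat_recr //= IH.
  rewrite [in RHS]big_nat_recr //= -!addrA; do 3 congr (_ + _).
    by rewrite mul2n doubleS.
  by rewrite mul2n doubleS addn1.
rewrite [in index_iota 0 _]dodd E /h dim_mE mulKn // mulnCA mulKn //.
have W a b j : (1 <= j)%N -> (i <= D)%N = a -> (2 * D < i)%N = b ->
    (weight i (2 * j) = if a then 3 else 0) *
    (weight i (2 * j + 1) = if b then 3 else 0).
  move=> j1 <- <-; rewrite /weight.
  have -> : ((2 * j)%N == 1%N) = false by lia.
  have -> : ((2 * j + 1)%N == 1%N) = false by lia.
  by rewrite oddD mul2n odd_double /= !(andbT, andbF, orbF).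
have [iD|Di] := leqP i D.
  rewrite mulr_sumr; congr (_ + _); apply: eq_big_nat => j /andP[j1 _].
  by rewrite !(W true false) ?mul0r ?addr0 //; apply/negbTE; lia.
have [i2D|Di2] := leqP i (2 * D).
  rewrite big_nat big1 ?addr0 // => j /andP[j1 _].
  by rewrite !(W false false) ?mul0r ?addr0 //; apply/negbTE; lia.
rewrite mulr_sumr; congr (_ + _); apply: eq_big_nat => j /andP[j1 _].
by rewrite !(W false true) ?mul0r ?add0r //; apply/negbTE; lia.
Qed.

(** The gradient of h_i, with entries numbered from 0. Coordinate k + 1 is the second argument of
    link k + 1 and the first argument of link k + 2; the latter exists only for k + 2 <= [dbar]. *)
Definition hgrad (i : nat) (z : 'cV[R]_dbar) (k : nat) : R :=
  weight i k.+1 * pairf_r (xcoord z k) (xcoord z k.+1) +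
  (if (k.+1 < dbar)%N then
     weight i k.+2 * pairf_l (xcoord z k.+1) (xcoord z k.+2) else 0).

Lemma norm_hgrad i z k : `|hgrad i z k| <= 12 + 12 * pi.
Proof.
have pi0 := @pi_gt0 R.
have A : `|weight i k.+1 * pairf_r (xcoord z k) (xcoord z k.+1)| <= 3 * 4.
  rewrite normrM (ger0_norm (weight_ge0 _ _)).
  by rewrite ler_pM ?weight_ge0 ?weight_le3 ?norm_pairf_r.
apply: le_trans (ler_normD _ _) _; case: ifP => _; last first.
  by rewrite normr0; lra.
have : `|weight i k.+2 * pairf_l (xcoord z k.+1) (xcoord z k.+2)| <= 3 * (4 * pi).
  rewrite normrM (ger0_norm (weight_ge0 _ _)).
  by rewrite ler_pM ?weight_ge0 ?weight_le3 ?norm_pairf_l.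
by lra.
Qed.

(** Weights of at most 3 multiply the Lipschitz constants 4, 4 of [pairf_r] and 16 pi, 8 of
    [pairf_l]. *)
Lemma hgrad_lipschitz i z z' k :
  `|hgrad i z k - hgrad i z' k| <= 12 * `|xcoord z k - xcoord z' k|
    + (48 * pi + 12) * `|xcoord z k.+1 - xcoord z' k.+1|
    + 24 * `|xcoord z k.+2 - xcoord z' k.+2|.
Proof.
have pi0 := @pi_gt0 R.
set d0 := `|xcoord z k - _|; set d1 := `|xcoord z k.+1 - _|.
set d2 := `|xcoord z k.+2 - _|.
have d0_ge0 : 0 <= d0 := normr_ge0 _; have d1_ge0 : 0 <= d1 := normr_ge0 _.
have d2_ge0 : 0 <= d2 := normr_ge0 _.
rewrite /hgrad opprD addrACA; apply: le_trans (ler_normD _ _) _.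
rewrite -mulrBr normrM (ger0_norm (weight_ge0 _ _)).
have A : weight i k.+1 * `|pairf_r (xcoord z k) (xcoord z k.+1) -
    pairf_r (xcoord z' k) (xcoord z' k.+1)| <= 3 * (4 * d0 + 4 * d1).
  by rewrite ler_pM ?weight_ge0 ?weight_le3 ?pairf_r_lipschitz.
case: ifP => _; last first.
  have : 0 <= pi * d1 by rewrite mulr_ge0 // ltW.
  by rewrite subr0 normr0 => ?; lra.
rewrite -mulrBr normrM (ger0_norm (weight_ge0 _ _)).
have : weight i k.+2 * `|pairf_l (xcoord z k.+1) (xcoord z k.+2) -
    pairf_l (xcoord z' k.+1) (xcoord z' k.+2)| <= 3 * (16 * pi * d1 + 8 * d2).
  by rewrite ler_pM ?weight_ge0 ?weight_le3 ?pairf_l_lipschitz.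
by lra.
Qed.

(** The band estimate applies with the constants 12, 48 pi + 12 and 24, whose sum 48 pi + 48 is at
    most 75 pi since pi >= 2. *)
Lemma sum_hgrad_lipschitz i z z' :
  \sum_(k < dbar) (hgrad i z k - hgrad i z' k) ^+ 2 <=
  (75 * pi) ^+ 2 * \sum_(k < dbar) (z k 0 - z' k 0) ^+ 2.
Proof.
have pi2 := @pi_ge2 R.
pose e j := `|xcoord z j - xcoord z' j|.
have e_ge0 j : 0 <= e j := normr_ge0 _.
apply: (@le_trans _ _ (\sum_(k < dbar)
    (12 * e k + (48 * pi + 12) * e k.+1 + 24 * e k.+2) ^+ 2)).
  apply: ler_sum => k _; rewrite -real_normK ?num_real //.
  by rewrite lerXn2r ?nnegrE //; [rewrite !addr_ge0 ?mulr_ge0 //; lra|exact: hgrad_lipschitz].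
apply: le_trans (band_sum_le _ _ _ _ _) _ => //; first lra.
- by rewrite /e /xcoord /= subrr normr0.
- by rewrite /e !xcoord_out // subrr normr0.
have -> : \sum_(k < dbar) e k.+1 ^+ 2 = \sum_(k < dbar) (z k 0 - z' k 0) ^+ 2.
  by apply: eq_bigr => k _; rewrite /e !xcoordS real_normK ?num_real.
rewrite ler_wpM2r ?sumr_ge0 // => [k _|]; first exact: sqr_ge0.
by rewrite lerXn2r ?nnegrE; lra.
Qed.

End Weights.

Lemma grad_is_diff (R : realType) n (F dF : 'cV[R]_n -> R) x k :
  is_diff x F dF -> grad F x k 0 = dF (delta_mx k 0).
Proof.
by move=> dFx; rewrite mxE deriveE ?diff_val //; exact: ex_diff.
Qed.

(** * Gradient, Lipschitz constant and lower bound of f_0 *)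

Section Smooth.
Context {R : realType} (eps Lf : R) (m1 m2 dbar : nat).
Hypotheses (eps0 : 0 < eps) (Lf0 : 0 < Lf) (m1_gt0 : (0 < m1)%N)
  (m2_gt0 : (0 < m2)%N) (dbar_odd : odd dbar).
Notation m := (dim_m m1 m2).
Notation vec := 'cV[R]_(m * dbar).
Implicit Types (x v : vec) (i : 'I_m).

Definition zscale : R := Num.sqrt m%:R * Lf / (150 * pi * eps).
Definition zblock x i : 'cV[R]_dbar := zscale *: block x i.

Lemma dim_m_gt0 : 0 < m%:R :> R.
Proof. by rewrite ltr0n dim_mE !muln_gt0 m1_gt0. Qed.

Lemma sqrt_m_gt0 : 0 < Num.sqrt m%:R :> R.
Proof. by rewrite sqrtr_gt0 dim_m_gt0. Qed.

Lemma sqr_sqrt_m : Num.sqrt m%:R ^+ 2 = m%:R :> R.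
Proof. by rewrite sqr_sqrtr // ltW ?dim_m_gt0. Qed.

Lemma zscale_gt0 : 0 < zscale.
Proof.
by rewrite divr_gt0 ?mulr_gt0 ?sqrt_m_gt0 ?pi_gt0.
Qed.

Lemma zblockE x i k : zblock x i k 0 = zscale * ent x i k.
Proof. by rewrite !mxE. Qed.

Lemma f0_instE x : f0_inst eps Lf x = \sum_(i < m)
  (300 * pi * eps ^+ 2 / (m%:R * Lf)) * \sum_(j < dbar) weight m1 m2 i.+1 j.+1 *
    pairf (xcoord (zblock x i) j) (xcoord (zblock x i) j.+1).
Proof.
apply: eq_bigr => i _; rewrite /f hE //; congr (_ * _).
by apply: eq_bigr => j _; rewrite varphiE.
Qed.

Definition dxcoord i j v : R :=
  if j == 0%N then 0 else zscale * Defs.coord (block v i) j.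

Lemma is_diff_xcoord i j x :
  is_diff x (fun y => xcoord (zblock y i) j) (dxcoord i j).
Proof.
have [->|j0] := eqVneq j 0%N; first exact: is_diff_cst.
have -> : (fun y => xcoord (zblock y i) j) =
    (fun y => zscale * \sum_(k < dbar | k.+1 == j) ent y i k).
  apply/funext => y; rewrite /xcoord (negbTE j0) mulr_sumr.
  by apply: eq_bigr => k _; rewrite zblockE.
have -> : dxcoord i j =
    (fun y => zscale * \sum_(k < dbar | k.+1 == j) ent y i k).
  apply/funext => y; rewrite /dxcoord (negbTE j0); congr (_ * _).
  by apply: eq_bigr => k _; rewrite mxE.
apply: is_diffZl; apply: is_diff_sum => k _; exact: is_diff_coord.
Qed.

Definition df0 x v : R := \sum_(i < m)
  (300 * pi * eps ^+ 2 / (m%:R * Lf)) * \sum_(j < dbar) weight m1 m2 i.+1 j.+1 *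
    (pairf_l (xcoord (zblock x i) j) (xcoord (zblock x i) j.+1) * dxcoord i j v +
     pairf_r (xcoord (zblock x i) j) (xcoord (zblock x i) j.+1) *
     dxcoord i j.+1 v).

Lemma is_diff_f0 x : is_diff x (@f0_inst R eps Lf m1 m2 dbar) (df0 x).
Proof.
have -> : @f0_inst R eps Lf m1 m2 dbar = (fun x => f0_inst eps Lf x) by [].
under eq_fun do rewrite f0_instE.
apply: is_diff_sum => i _; apply: is_diffZl; apply: is_diff_sum => j _.
apply: is_diffZl; apply: is_diff_pairf; exact: is_diff_xcoord.
Qed.

Lemma dxcoord_delta i i' j (k : 'I_dbar) :
  dxcoord i' j (delta_mx (mxtens_index (i, k)) 0) =
  zscale * ((i' == i) && (j == k.+1))%:R.
Proof.
rewrite /dxcoord; case: j => [|j] /=; first by rewrite andbF mulr0.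
congr (_ * _); rewrite /Defs.coord eqSS.
under eq_bigr do rewrite !mxE eqxx andbT (inj_eq (can_inj (@mxtens_indexK _ _))).
have [-> /=|jk] := eqVneq j k.
  by rewrite (big_pred1 k) => [|l]; rewrite ?andbT ?xpair_eqE ?eqxx ?andbT //= eqSS.
rewrite andbF big1 // => l; rewrite eqSS => /eqP lj.
rewrite xpair_eqE; have [lk|] := eqVneq l k; last by rewrite andbF.
by rewrite -lj lk eqxx in jk.
Qed.

(** Only the links j = k and j = k + 1 of block i see this entry, and the factor in front of h_i
    times [zscale] equals 2 eps / sqrt m. *)
Lemma grad_f0 x i (k : 'I_dbar) :
  ent (grad (@f0_inst R eps Lf m1 m2 dbar) x) i k =
  2 * eps / Num.sqrt m%:R * hgrad m1 m2 i.+1 (zblock x i) k.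
Proof.
rewrite /ent (grad_is_diff _ (is_diff_f0 x)) /df0 (bigD1 i) //= [X in _ + X]big1.
  under eq_bigr do rewrite !dxcoord_delta !eqxx /= mulrDr eqSS.
  rewrite addr0 big_split /=.
  have -> : \sum_(j < dbar) weight m1 m2 i.+1 j.+1 *
      (pairf_l (xcoord (zblock x i) j) (xcoord (zblock x i) j.+1) *
       (zscale * (j == k.+1 :> nat)%:R)) = zscale * (if (k.+1 < dbar)%N then
      weight m1 m2 i.+1 k.+2 *
      pairf_l (xcoord (zblock x i) k.+1) (xcoord (zblock x i) k.+2) else 0).
    case: ifP => [kd|/negbT kd].
      rewrite (bigD1 (Ordinal kd)) //= eqxx big1 => [/=|j jk]; first by ring.
      by rewrite -val_eqE /= in jk; rewrite (negbTE jk) !mulr0.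
    rewrite mulr0 big1 // => j _; rewrite ltn_eqF ?mulr0 //.
    by have := ltn_ord j; lia.
  rewrite (bigD1 k) //= eqxx big1 => [|j jk]; last first.
    by rewrite -val_eqE /= in jk; rewrite (negbTE jk) !mulr0.
  rewrite /hgrad /zscale (_ : true%:R = 1) //; move: sqr_sqrt_m sqrt_m_gt0.
  move: (Num.sqrt m%:R : R) => r <- r0.
  set c := (if _ then _ else _); set w := weight _ _ _ _; set p := pairf_r _ _.
  move: c w p => c w p.
  move: (@pi R) (@pi_gt0 R) => q q0.
  by field; rewrite !gt_eqF.
move=> i' i'i; rewrite big1 ?mulr0 // => j _.
by rewrite !dxcoord_delta (negbTE i'i) !mulr0 addr0 mulr0.
Qed.

Lemma grad_f0_lipschitz x y :
  norm2 (grad (@f0_inst R eps Lf m1 m2 dbar) x -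
         grad (@f0_inst R eps Lf m1 m2 dbar) y) <= Lf * norm2 (x - y).
Proof.
rewrite -ler_sqr ?nnegrE ?mulr_ge0 ?norm2_ge0 ?(ltW Lf0) //.
rewrite exprMn !sqr_norm2_ent mulr_sumr; apply: ler_sum => i _.
have gE (k : 'I_dbar) :
    ent (grad (@f0_inst R eps Lf m1 m2 dbar) x -
         grad (@f0_inst R eps Lf m1 m2 dbar) y) i k ^+ 2 =
    (2 * eps / Num.sqrt m%:R) ^+ 2 *
    (hgrad m1 m2 i.+1 (zblock x i) k - hgrad m1 m2 i.+1 (zblock y i) k) ^+ 2.
  by rewrite entB -exprMn mulrBr; congr ((_ - _) ^+ 2); exact: grad_f0.
rewrite (eq_bigr _ (fun k _ => gE k)) -mulr_sumr.
apply: le_trans (ler_wpM2l (sqr_ge0 _) (sum_hgrad_lipschitz _ _ _ _ _)) _.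
under eq_bigr do rewrite !zblockE -mulrBr exprMn -entB.
rewrite -mulr_sumr !mulrA ler_wpM2r ?sumr_ge0 // => [k _|]; first exact: sqr_ge0.
(* The constants match exactly: (2 eps / sqrt m) * 75 pi * [zscale] = Lf. *)
rewrite le_eqVlt; apply/orP; left; apply/eqP.
rewrite /zscale; move: sqrt_m_gt0; move: (Num.sqrt m%:R : R) => r r0.
move: (@pi R) (@pi_gt0 R) => q q0.
by field; rewrite !gt_eqF.
Qed.

(** Every link is at least -4 pi and the weights add up to m * dbar. At 0 all links are at most 0:
    the first is negative and the others vanish with their first argument. *)
Lemma f0_inst_lower x :
  f0_inst eps Lf (0 : vec) - 1200 * pi ^+ 2 * eps ^+ 2 * dbar%:R / Lf <=
  f0_inst eps Lf x.
Proof.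
have c0 : 0 <= 300 * pi * eps ^+ 2 / (m%:R * Lf) :> R.
  apply: divr_ge0; last by rewrite mulr_ge0 // ltW.
  exact: mulr_ge0 (mulr_ge0 (ler0n _ 300) (@pi_ge0 R)) (sqr_ge0 eps).
rewrite !f0_instE -!mulr_sumr.
have -> : 1200 * pi ^+ 2 * eps ^+ 2 * dbar%:R / Lf =
    300 * pi * eps ^+ 2 / (m%:R * Lf) * (4 * pi * (m%:R * dbar%:R)).
  move: (m%:R : R) dim_m_gt0 (@pi R) => r r0 q.
  by field; rewrite !gt_eqF.
rewrite -mulrBr ler_wpM2l // lerBlDr.
have -> : m%:R * dbar%:R = \sum_(i < m) \sum_(j < dbar) weight m1 m2 i.+1 j.+1 :> R.
  rewrite exchange_big /=; under eq_bigr do rewrite sum_weight.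
  by rewrite sumr_const card_ord mulr_natr.
rewrite mulr_sumr -big_split /=; apply: ler_sum => i _.
rewrite mulr_sumr -big_split /=; apply: ler_sum => j _.
rewrite [4 * pi * _]mulrC -mulrDr ler_wpM2l ?weight_ge0 //.
apply: (@le_trans _ _ 0); last by rewrite -lerBlDr sub0r pairf_ge.
case: (nat_of_ord j) => [|j']; last first.
  have -> : xcoord (zblock 0 i) j'.+1 = 0.
    rewrite /xcoord /= /Defs.coord big1 // => k _.
    by rewrite zblockE ent0 mulr0.
  by rewrite pairf_0l.
rewrite /xcoord /= /pairf [Psi (- 1)]Psi_le0 ?lerN10 // mul0r sub0r oppr_le0.
by rewrite mulr_ge0 ?Psi_ge0 // ltW ?Phi_gt0.
Qed.

End Smooth.

(** * The zero chain *)

Lemma span_ind (K : fieldType) (vT : vectType K) (Q : vT -> Prop) (s : seq vT) :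
  Q 0 -> (forall a u v, Q u -> Q v -> Q (a *: u + v)) ->
  {in s, forall u, Q u} -> forall v, v \in << s >>%VS -> Q v.
Proof.
move=> Q0 QZD Qs v /(coord_span (X := in_tuple s)) ->.
elim/big_ind: _ => // [u w Qu Qw|i _]; first by rewrite -[u]scale1r; exact: QZD.
by rewrite -[_ *: _]addr0; apply: QZD => //; apply: Qs; exact: mem_nth.
Qed.

Section Matrices.
Context {R : realType} (Lf : R) (m1 m2 dbar : nat).
Notation m := (dim_m m1 m2).
Notation D := (m1 * m2)%N.
Notation vec := 'cV[R]_(m * dbar).
Implicit Types (x : vec) (k : 'I_m.-1) (i : 'I_m).

(** Row k of J_m is an edge of the path of blocks; [klo k] and [khi k] are its ends. *)
Definition klo k : 'I_m := widen_ord (leq_pred m) k.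
Lemma khi_proof k : (k.+1 < m)%N. Proof. by have := ltn_ord k; lia. Qed.
Definition khi k : 'I_m := Ordinal (khi_proof k).

Lemma klo_neq_khi k : klo k != khi k.
Proof. by rewrite -val_eqE /= ltn_eqF. Qed.

Lemma sum_J k (X : 'I_m -> R) :
  \sum_i J m1 m2 k i * X i = X (khi k) - X (klo k).
Proof.
rewrite (bigD1 (khi k)) //= (bigD1 (klo k)) ?klo_neq_khi //= big1.
  rewrite !mxE /= eqxx (gtn_eqF (ltnSn k)) eqxx; ring.
move=> i /andP[]; rewrite -!val_eqE /= => ihi ilo.
by rewrite mxE (negbTE ihi) (negbTE ilo) mul0r.
Qed.

Lemma J_neq0 k i : J m1 m2 k i != 0 :> R -> i = klo k \/ i = khi k.
Proof.
rewrite mxE; have [ik|_] := eqVneq (i : nat) k; first by left; exact/val_inj.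
by have [ik|_] := eqVneq (i : nat) k.+1; [right; exact/val_inj|rewrite eqxx].
Qed.

Section Rows.
Variable S : {set 'I_m.-1}.

(* [Abar_inst] and [A_inst] are the cases [S = calM] and [S = calMC]. *)
Definition rows_inst : 'M[R]_(#|S| * dbar, m * dbar) :=
  (m%:R * Lf) *: (rowsub (@enum_val _ (mem S)) (J m1 m2) *t 1%:M).

Lemma ent_rows x a l : ent (rows_inst *m x) a l =
  m%:R * Lf * (ent x (khi (enum_val a)) l - ent x (klo (enum_val a)) l).
Proof.
rewrite /rows_inst -scalemxAl entZ ent_tens1.
by under eq_bigr do rewrite mxE; rewrite sum_J.
Qed.

Lemma ent_rowsT (y : 'cV[R]_(#|S| * dbar)) i l : ent (rows_inst^T *m y) i l =
  m%:R * Lf * \sum_a J m1 m2 (enum_val a) i * ent y a l.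
Proof.
rewrite /rows_inst linearZ /= trmx_tens trmx1.
rewrite -scalemxAl entZ ent_tens1.
by congr (_ * _); apply: eq_bigr => a _; rewrite 2!mxE.
Qed.

Lemma ent_rowsT_eq0 (y : 'cV[R]_(#|S| * dbar)) i l :
  (forall a, i = klo (enum_val a) \/ i = khi (enum_val a) -> ent y a l = 0) ->
  ent (rows_inst^T *m y) i l = 0.
Proof.
move=> y0; rewrite ent_rowsT big1 ?mulr0 // => a _.
have [->|/J_neq0/y0 ->] := eqVneq (J m1 m2 (enum_val a) i) (0 : R).
  by rewrite mul0r.
by rewrite mulr0.
Qed.

End Rows.

(* No iterate before [tau b c] reaches coordinate [c] of block [b]: even
   coordinates are created in the first third of the blocks, odd ones in the
   last third, and a nonzero coordinate travels one block per iteration. *)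
Definition tau (b c : nat) : nat :=
  if (c <= 1)%N then 0%N
  else ((c - 2) * D + (if odd c then 2 * D + 1 - b else b - D))%N.

Lemma tau_ge b c : ((c - 2) * D <= tau b c)%N.
Proof.
rewrite /tau; case: ifP => [c1|_]; last exact: leq_addr.
by rewrite (_ : c - 2 = 0)%N //; lia.
Qed.

Lemma tau_nextl b c : (tau b c <= (tau b.+1 c).+1)%N.
Proof. by rewrite /tau; case: ifP => // _; case: (odd c); lia. Qed.

Lemma tau_nextr b c : (tau b.+1 c <= (tau b c).+1)%N.
Proof. by rewrite /tau; case: ifP => // _; case: (odd c); lia. Qed.

(** Where the weight is nonzero, the truncated difference in [tau b c.+2] is 0, leaving c D. For c >
    0, coordinate c + 1 comes from the opposite third, more than D blocks away, so its [tau] exceeds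
    c D. *)
Lemma tau_weight b c : weight m1 m2 b c.+2 != 0 :> R ->
  (tau b c.+2 <= (tau b c.+1).+1)%N.
Proof.
rewrite /weight /=; case: ifP => [H _|]; last by rewrite eqxx.
rewrite /tau /=; case: c H => [|c]; rewrite ?ltnS /=.
  by rewrite andbT andbF orbF; lia.
by case: (odd c) => /=; nia.
Qed.

Definition reachX (t : nat) x :=
  forall i (l : 'I_dbar), (t < tau i.+1 l.+1)%N -> ent x i l = 0.

Section ReachY.
Variable S : {set 'I_m.-1}.
Implicit Types y : 'cV[R]_(#|S| * dbar).

(** Entries of y live on edges. An edge may be nonzero at time t only if one of its ends has [tau] <
    t, so that passing from a block to an edge costs one iteration and passing from an edge to a
    block costs none. *)
Definition reachY (t : nat) y := forall a (l : 'I_dbar),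
  (t <= tau (klo (enum_val a)).+1 l.+1)%N ->
  (t <= tau (khi (enum_val a)).+1 l.+1)%N -> ent y a l = 0.

Lemma reachX_rows t x : reachX t x -> reachY t.+1 (rows_inst S *m x).
Proof.
by move=> xt a l lo hi; rewrite ent_rows !xt // subrr mulr0.
Qed.

(** [tau] differs by at most 1 between neighbouring blocks, so t < [tau] at one end of an edge gives
    t <= [tau] at both ends. *)
Lemma reachY_rowsT t y : reachY t y -> reachX t ((rows_inst S)^T *m y).
Proof.
move=> yt i l ti; apply: ent_rowsT_eq0 => a ia; apply: yt.
  by case: ia => ia; move: ti; rewrite ia /=; have := tau_nextr (enum_val a).+1 l.+1; lia.
by case: ia => ia; move: ti; rewrite ia /=; have := tau_nextl (enum_val a).+1 l.+1; lia.
Qed.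

Lemma reachX_rowsT_rows t x :
  reachX t x -> reachX t.+1 ((rows_inst S)^T *m (rows_inst S *m x)).
Proof. by move=> xt; apply: reachY_rowsT; exact: reachX_rows. Qed.

Lemma reachY_le s t y : (s <= t)%N -> reachY s y -> reachY t y.
Proof. by move=> st ys a l lo hi; apply: ys; exact: leq_trans st _. Qed.

Lemma reachY0 t : reachY t 0.
Proof. by move=> a l _ _; rewrite ent0. Qed.

Lemma reachY_span t (s : seq 'cV[R]_(#|S| * dbar)) :
  {in s, forall u, reachY t u} -> forall v, v \in << s >>%VS -> reachY t v.
Proof.
apply: span_ind; first exact: reachY0.
move=> c u v ut vt a l lo hi; rewrite entD vt // addr0.
by rewrite entZ ut // mulr0.
Qed.

End ReachY.

Lemma reachX_le s t x : (s <= t)%N -> reachX s x -> reachX t x.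
Proof. by move=> st xs i l tl; apply: xs; exact: leq_ltn_trans tl. Qed.

Lemma reachX0 t : reachX t 0.
Proof. by move=> i l _; rewrite ent0. Qed.

Lemma reachX_span t (s : seq vec) :
  {in s, forall u, reachX t u} -> forall v, v \in << s >>%VS -> reachX t v.
Proof.
apply: span_ind; first exact: reachX0.
move=> c u v ut vt i l tl; rewrite entD vt // addr0.
by rewrite entZ ut // mulr0.
Qed.

(** If entry l of x is 0, the [pairf_l] term vanishes. The [pairf_r] term vanishes with its weight
    or, by [tau_weight], with the preceding coordinate. *)
Lemma reachX_grad eps t x : 0 < eps -> 0 < Lf -> (0 < m1)%N -> (0 < m2)%N ->
  odd dbar ->
  reachX t x -> reachX t.+1 (grad (@f0_inst R eps Lf m1 m2 dbar) x).
Proof.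
move=> eps0 Lf0 m10 m20 dodd xt i l tl.
rewrite grad_f0 // /hgrad.
have xl0 (l' : 'I_dbar) : (t < tau i.+1 l'.+1)%N ->
    xcoord (zblock eps Lf x i) l'.+1 = 0.
  by move=> tl'; rewrite xcoordS zblockE xt ?mulr0.
have -> : (if (l.+1 < dbar)%N then weight m1 m2 i.+1 l.+2 *
    pairf_l (xcoord (zblock eps Lf x i) l.+1) (xcoord (zblock eps Lf x i) l.+2)
    else 0) = 0 :> R.
  by rewrite xl0 ?pairf_l0 ?mulr0 ?if_same //; lia.
have [->|w0] := eqVneq (weight m1 m2 i.+1 l.+1) (0 : R).
  by rewrite mul0r addr0 mulr0.
(* The first coordinate has [tau] equal to 0, which contradicts t + 1 < [tau]. *)
case: l => -[|l] ld /= in tl xl0 w0 *; first by rewrite /tau in tl.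
have /= := xl0 (Ordinal (ltnW ld)).
move=> ->; first by rewrite pairf_r0 mulr0 addr0 mulr0.
by have := tau_weight w0; lia.
Qed.

(** Replacing entry e of z by 0 does not increase the l1 term and, as y is 0 there, strictly
    decreases the quadratic term unless the entry was 0 already. *)
Lemma is_prox_gbar_eq0 (beta eta : R) (y z : 'cV[R]_(#|calM m1 m2| * dbar)) e :
  0 < beta -> 0 < Lf -> 0 < eta ->
  is_prox (gbar_inst Lf beta) eta y z -> y e 0 = 0 -> z e 0 = 0.
Proof.
move=> beta0 Lf0 eta0 /(_ (z - z e 0 *: delta_mx e 0)) + yk.
set z' := z - _ *: _.
have z'E j : z' j 0 = if j == e then 0 else z j 0.
  rewrite !mxE eqxx andbT; case: eqP => [->|_]; first by rewrite mulr1 subrr.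
  by rewrite mulr0 subr0.
have E1 : norm1 z = `|z e 0| + norm1 z'.
  rewrite /norm1 (bigD1 e) //= [in RHS](bigD1 e) //= z'E eqxx normr0 add0r.
  by congr (_ + _); apply: eq_bigr => j /negbTE je; rewrite z'E je.
have E2 : norm2 (z - y) ^+ 2 = z e 0 ^+ 2 + norm2 (z' - y) ^+ 2.
  rewrite !sqr_norm2 (bigD1 e) //= [in RHS](bigD1 e) //=.
  rewrite [(z - y) e 0]mxE [(z' - y) e 0]mxE z'E eqxx mxE yk oppr0 !addr0.
  rewrite expr0n add0r; congr (_ + _); apply: eq_bigr => j /negbTE je.
  by rewrite ![(_ - y) j 0]mxE z'E je.
rewrite /gbar_inst -!EFinD lee_fin E1 E2 !mulrDr -!addrA -subr_ge0.
set a := beta / _; set b := (2 * eta)^-1.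
have a0 : 0 <= a by rewrite divr_ge0 ?mulr_ge0 // ltW.
have b0 : 0 < b by rewrite invr_gt0 mulr_gt0.
have : 0 <= a * `|z e 0| by rewrite mulr_ge0.
have [//|zn0] := eqVneq (z e 0) 0.
have : 0 < b * z e 0 ^+ 2 by rewrite mulr_gt0 // exprn_even_gt0.
by lra.
Qed.

(** Strong induction on both sequences together: each vector allowed in the spans advances the
    invariants of the earlier iterates by at most one iteration, and the prox acts entry by
    entry. *)
Lemma zero_chain (eps beta : R) (x : nat -> vec)
    (y : nat -> 'cV[R]_(#|calM m1 m2| * dbar)) :
  0 < eps -> 0 < beta -> 0 < Lf -> (0 < m1)%N -> (0 < m2)%N -> odd dbar ->
  x 0%N = 0 -> y 0%N = 0 ->
  linear_span (inst eps Lf m1 m2 dbar beta) x y ->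
  forall t, reachX t (x t).
Proof.
move=> eps0 beta0 Lf0 m10 m20 dodd x0 y0 xy.
suff H t s : (s <= t)%N -> reachX s (x s) /\ reachY s (y s).
  by move=> t; case: (H t t (leqnn t)).
elim: t s => [|t IH] s.
  by rewrite leqn0 => /eqP ->; rewrite x0 y0; split; [exact: reachX0|exact: reachY0].
rewrite leq_eqVlt => /orP[/eqP -> {s}|]; last exact: IH.
have IHx s : (s < t.+1)%N -> reachX s (x s) by case/IH.
have {IH} IHy s : (s < t.+1)%N -> reachY s (y s) by case/IH.
have [xt [xi [zeta [xit [eta eta0 zetat] yt]]]] := xy t.+1 isT.
have mem_flat (T : eqType) (F : nat -> seq T) (u : T) :
    u \in flatten [seq F s | s <- iota 0 t.+1] -> exists2 s, (s < t.+1)%N & u \in F s.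
  by move=> /flattenP[_ /mapP[s + ->]]; rewrite mem_iota => ? ?; exists s.
split.
  apply: reachX_span xt => u; rewrite mem_cat => /orP[|/mem_flat[s st]].
    by rewrite !inE !mulmx0 orbb => /eqP ->; exact: reachX0.
  have IHs := IHx s st; have IHs1 := reachX_le (leqnSn s) IHs.
  rewrite !inE => /orP[/eqP ->|/orP[/eqP ->|/orP[/eqP ->|/orP[/eqP ->|/eqP ->]]]].
  - exact: reachX_le (ltnW st) IHs.
  - by apply: (reachX_le st); exact: reachX_grad.
  - by apply: (reachX_le st); exact: reachX_rowsT_rows.
  - by apply: (reachX_le st); exact: reachX_rowsT_rows.
  - by apply: reachX_le (ltnW st) _; apply: reachY_rowsT; exact: IHy.
have {}xit : reachY t.+1 xi.
  apply: reachY_span xit => u; rewrite inE => /orP[/eqP ->|/mem_flat[s st]].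
    exact: reachY0.
  rewrite !inE => /orP[/eqP ->|/orP[/eqP ->|/eqP ->]].
  - by apply: reachY_le (ltnW st) _; exact: IHy.
  - by apply: (reachY_le st); apply: reachX_rows; apply: reachY_rowsT; exact: IHy.
  - by apply: (reachY_le st); apply: reachX_rows; exact: IHx.
apply: reachY_span yt => u; rewrite !inE => /orP[/eqP -> //|/eqP ->].
move=> a l lo hi; apply: is_prox_gbar_eq0 zetat _ => //; exact: xit.
Qed.

End Matrices.

(** * The condition number *)

Section PathLaplacian.
Context {R : realType} (m1 m2 : nat).
Notation m := (dim_m m1 m2).
Hypothesis m_gt0 : (0 < m)%N.
Variable U : 'I_m.-1 -> R.

(** [U] shifted by one and extended by 0 at both ends, so that J^T U is the sequence of differences
    V i - V (i + 1). *)
Let V (j : nat) : R := \sum_(k < m.-1 | k.+1 == j) U k.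

Let VS (k : 'I_m.-1) : V k.+1 = U k.
Proof. by rewrite /V (big_pred1 k) // => i /=; rewrite eqSS. Qed.

Let V0 : V 0 = 0. Proof. by rewrite /V big_pred0. Qed.

Let Vm : V m = 0.
Proof.
rewrite /V big_pred0 // => k; apply/negbTE.
by have := ltn_ord k; lia.
Qed.

Let JTE (i : 'I_m) : \sum_k J m1 m2 k i * U k = V i - V i.+1.
Proof.
rewrite /V [in RHS]big_mkcond [X in _ - X]big_mkcond -sumrB.
apply: eq_bigr => k _; rewrite mxE eqSS (eq_sym (k : nat)) (eq_sym k.+1).
have [->|_] := eqVneq (i : nat) k; first by rewrite ltn_eqF //; ring.
by case: ifP => _; ring.
Qed.

Let sumV : \sum_(k < m.-1) V k.+1 ^+ 2 = \sum_k U k ^+ 2.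
Proof. by apply: eq_bigr => k _; rewrite VS. Qed.

Lemma sum_sqr_JT_le :
  \sum_i (\sum_k J m1 m2 k i * U k) ^+ 2 <= 4 * \sum_k U k ^+ 2.
Proof.
have H1 : \sum_(i < m) V i ^+ 2 = \sum_k U k ^+ 2.
  rewrite -sumV -(big_mkord xpredT (fun i => V i ^+ 2)).
  rewrite -(big_mkord xpredT (fun i => V i.+1 ^+ 2)) -[in LHS](prednK m_gt0).
  by rewrite big_nat_recl // V0 expr0n add0r.
have H2 : \sum_(i < m) V i.+1 ^+ 2 = \sum_k U k ^+ 2.
  rewrite -sumV -(big_mkord xpredT (fun i => V i.+1 ^+ 2)).
  rewrite -(big_mkord xpredT (fun i => V i.+1 ^+ 2)) -[in LHS](prednK m_gt0).
  by rewrite big_nat_recr //= prednK // Vm expr0n addr0.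
apply: (@le_trans _ _ (\sum_(i < m) (2 * V i ^+ 2 + 2 * V i.+1 ^+ 2))).
  apply: ler_sum => i _; rewrite JTE.
  by have := sqr_ge0 (V i + V i.+1); lra.
by rewrite big_split /= -!mulr_sumr H1 H2; lra.
Qed.

(* Discrete Poincare inequality for paths vanishing at both ends. *)
Lemma sum_sqr_JT_ge :
  \sum_k U k ^+ 2 <= m%:R ^+ 2 * \sum_i (\sum_k J m1 m2 k i * U k) ^+ 2.
Proof.
under [in leRHS]eq_bigr do rewrite JTE.
set Q := \sum_(i < m) _; have Q0 : 0 <= Q.
  by apply: sumr_ge0 => i _; exact: sqr_ge0.
have UQ k : U k ^+ 2 <= m%:R * Q.
  have km : (k.+1 <= m)%N by have := ltn_ord k; lia.
  (* Up to sign, [U k] = V (k + 1) telescopes from V 0 = 0, which prepares Cauchy-Schwarz. *)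
  have -> : U k ^+ 2 = (\sum_(i < m | (i < k.+1)%N) (V i - V i.+1)) ^+ 2.
    rewrite -(big_ord_widen _ (fun i => V i - V i.+1) km).
    rewrite -(big_mkord xpredT (fun i => V i - V i.+1)) -[RHS]sqrrN -sumrN.
    under eq_bigr do rewrite opprB.
    by rewrite telescope_sumr // V0 subr0 VS.
  exact: sqr_sum_le.
apply: le_trans (ler_sum _ (fun k _ => UQ k)) _.
rewrite sumr_const card_ord -[_ *+ m.-1]mulr_natl expr2 -mulrA ler_wpM2r ?mulr_ge0 //.
by rewrite ler_nat leq_pred.
Qed.

End PathLaplacian.

Section ConditionNumber.
Context {R : realType} (Lf : R) (m1 m2 dbar : nat).
Notation m := (dim_m m1 m2).
Hypotheses (Lf0 : 0 < Lf) (m_gt0 : (0 < m)%N).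

(** Serves to merge the components of a vector on the rows of [Abar_inst] and of [A_inst] into one
    vector on all rows of J_m. *)
Lemma enum_val_ext (T : finType) (S : {set T}) (V : Type) (v0 : V)
  (u : 'I_#|S| -> V) : exists U : T -> V, forall a, u a = U (enum_val a).
Proof.
have [S0|/card_gt0P[s sS]] := posnP #|S|.
  by exists (fun=> v0) => a; have := ltn_ord a; rewrite [X in (_ < X)%N]S0.
by exists (fun t => u (enum_rank_in sS t)) => a; rewrite enum_valK_in.
Qed.

Notation M := (col_mx (Abar_inst Lf m1 m2 dbar) (A_inst Lf m1 m2 dbar)).

(** Up to the order of its rows, the stacked matrix is m Lf times J_m tensored with the identity.
    The path inequalities hold for each coordinate l, and the factor (m Lf)^2 turns their constants
    1 / m^2 and 4 into the ones stated. *)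
Lemma stacked_trmx_bounds (u : 'cV[R]_(#|calM m1 m2| * dbar + #|calMC m1 m2| * dbar)) :
  Lf ^+ 2 * norm2 u ^+ 2 <= norm2 (M^T *m u) ^+ 2 <=
  4 * m%:R ^+ 2 * Lf ^+ 2 * norm2 u ^+ 2.
Proof.
have [U1 U1E] := enum_val_ext (fun=> 0) (fun a l => ent (usubmx u) a l).
have [U2 U2E] := enum_val_ext (fun=> 0) (fun a l => ent (dsubmx u) a l).
pose U l k := if k \in calM m1 m2 then U1 k l else U2 k l.
have Msum (F1 F2 : 'I_m.-1 -> R) :
    \sum_(a < #|calM m1 m2|) F1 (enum_val a) +
    \sum_(a < #|calMC m1 m2|) F2 (enum_val a) =
    \sum_k (if k \in calM m1 m2 then F1 k else F2 k).
  rewrite -!big_enum_val [in RHS](bigID (mem (calM m1 m2))) /=; congr (_ + _).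
    by apply: eq_bigr => k ->.
  by apply: eq_big => k; rewrite /calMC ?inE // => /negbTE ->.
have uE : norm2 u ^+ 2 = \sum_l \sum_k U l k ^+ 2.
  rewrite -[u]vsubmxK sqr_norm2 big_split_ord /=.
  under eq_bigr do rewrite col_mxEu.
  under [X in _ + X]eq_bigr do rewrite col_mxEd.
  rewrite !sum_mxtens exchange_big [X in _ + X]exchange_big /= -big_split /=.
  apply: eq_bigr => l _.
  under eq_bigr do rewrite -/(ent (usubmx u) _ _) (congr1 (@^~ l) (U1E _)).
  under [X in _ + X]eq_bigr do
    rewrite -/(ent (dsubmx u) _ _) (congr1 (@^~ l) (U2E _)).
  rewrite (Msum (fun k => U1 k l ^+ 2) (fun k => U2 k l ^+ 2)).
  by apply: eq_bigr => k _; rewrite /U; case: ifP.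
have wE i l : ent (M^T *m u) i l =
    m%:R * Lf * \sum_k J m1 m2 k i * U l k.
  rewrite -[u in LHS]vsubmxK tr_col_mx mul_row_col entD.
  rewrite (@ent_rowsT R Lf m1 m2 dbar (calM m1 m2)).
  rewrite (@ent_rowsT R Lf m1 m2 dbar (calMC m1 m2)) -mulrDr.
  under eq_bigr do rewrite (congr1 (@^~ l) (U1E _)).
  under [X in _ + X]eq_bigr do rewrite (congr1 (@^~ l) (U2E _)).
  rewrite (Msum (fun k => J m1 m2 k i * U1 k l) (fun k => J m1 m2 k i * U2 k l)).
  by congr (_ * _); apply: eq_bigr => k _; rewrite /U; case: ifP.
have -> : norm2 (M^T *m u) ^+ 2 = (m%:R * Lf) ^+ 2 *
    \sum_l \sum_i (\sum_k J m1 m2 k i * U l k) ^+ 2.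
  rewrite sqr_norm2_ent exchange_big /= mulr_sumr; apply: eq_bigr => l _.
  by rewrite mulr_sumr; apply: eq_bigr => i _; rewrite wE exprMn.
rewrite uE; set S := \sum_l _; set T := \sum_l _.
have lo : S <= m%:R ^+ 2 * T.
  by rewrite mulr_sumr; apply: ler_sum => l _; exact: sum_sqr_JT_ge.
have hi : T <= 4 * S.
  by rewrite mulr_sumr; apply: ler_sum => l _; exact: sum_sqr_JT_le.
apply/andP; split.
  have -> : (m%:R * Lf) ^+ 2 * T = Lf ^+ 2 * (m%:R ^+ 2 * T) by ring.
  by rewrite ler_wpM2l ?sqr_ge0.
have -> : 4 * m%:R ^+ 2 * Lf ^+ 2 * S = (m%:R * Lf) ^+ 2 * (4 * S) by ring.
by rewrite ler_wpM2l ?sqr_ge0.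
Qed.

(** For a left eigenvector v, the Rayleigh quotient of M M^T at v^T is a, and the previous bounds
    confine it. *)
Lemma eigenvalue_stacked (a : R) : eigenvalue (M *m M^T) a ->
  Lf ^+ 2 <= a <= 4 * m%:R ^+ 2 * Lf ^+ 2.
Proof.
case/eigenvalueP => v vM v0.
have vv : 0 < norm2 v^T ^+ 2.
  have [i vi] : exists i, v 0 i != 0 by apply/rV0Pn.
  rewrite sqr_norm2 (bigD1 i) //= mxE ltr_pwDl ?exprn_even_gt0 //.
  by apply: sumr_ge0 => j _; exact: sqr_ge0.
have dotE n (w : 'cV[R]_n) : norm2 w ^+ 2 = (w^T *m w) 0 0.
  by rewrite sqr_norm2 mxE; apply: eq_bigr => j _; rewrite mxE expr2.
have aE : norm2 (M^T *m v^T) ^+ 2 = a * norm2 v^T ^+ 2.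
  by rewrite !dotE trmx_mul !trmxK mulmxA -(mulmxA v) vM -scalemxAl mxE.
have := stacked_trmx_bounds v^T; rewrite aE => /andP[].
by rewrite !ler_pM2r // => -> ->.
Qed.

Lemma kappa_le : 0 <= kappa M <= 2 * m%:R.
Proof.
rewrite /kappa sqrtr_ge0 /=.
set s := sup _; set i := inf _.
have m0 : 0 <= m%:R :> R by [].
have Lf20 : 0 < Lf ^+ 2 by rewrite exprn_gt0.
have sle : s <= 4 * m%:R ^+ 2 * Lf ^+ 2.
  rewrite /s; have [->|ne] := eqVneq [set a : R | eigenvalue (M *m M^T) a] set0.
    by rewrite sup0 mulr_ge0 ?sqr_ge0 // mulr_ge0 ?sqr_ge0.
  apply: sup_le_ub; first exact/set0P.
  by move=> a /= /eigenvalue_stacked /andP[].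
(* The infimum of an empty set is 0 by default; division by 0 then makes [kappa] equal to 0, within
   the bound. *)
have [i0|ile] : i = 0 \/ Lf ^+ 2 <= i.
  rewrite /i; have [->|ne] := eqVneq [set a : R | 0 < a /\ eigenvalue (M *m M^T) a] set0.
    by left; rewrite inf0.
  right; apply: lb_le_inf; first exact/set0P.
  by move=> a /= [_ /eigenvalue_stacked /andP[]].
  by rewrite i0 invr0 mulr0 sqrtr0 mulr_ge0.
have -> : 2 * m%:R = Num.sqrt ((2 * m%:R) ^+ 2) :> R.
  by rewrite sqrtr_sqr ger0_norm ?mulr_ge0.
apply: ler_wsqrtr.
rewrite ler_pdivrMr; last exact: lt_le_trans ile.
apply: le_trans sle _.
have -> : (2 * m%:R) ^+ 2 = 4 * m%:R ^+ 2 :> R by ring.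
by rewrite ler_wpM2l ?mulr_ge0 ?sqr_ge0.
Qed.

End ConditionNumber.

(** * Translation and the nonsmooth part *)

Section Translation.
Context {R : realType} {d n nbar : nat} (P : problem R d n nbar) (x0 : 'cV[R]_d).
Implicit Types x : 'cV[R]_d.

Lemma grad_shift (F : 'cV[R]_d -> R) x :
  grad (fun y => F (y - x0)) x = grad F (x - x0).
Proof.
apply/colP => k; rewrite !mxE /derive.
suff -> : (fun y => F (y - x0)) \o shift x = F \o shift (x - x0) by [].
by apply/funext => t /=; rewrite addrA.
Qed.

Lemma g_translate x : g (translate x0 P) x = g P (x - x0).
Proof. by rewrite /g /= mulmxBr addrA addrAC. Qed.

Lemma F0_translate x : F0 (translate x0 P) x = F0 P (x - x0).
Proof. by rewrite /F0 g_translate. Qed.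

Lemma infF0_translate : infF0 (translate x0 P) = infF0 P.
Proof.
rewrite /infF0; congr ereal_inf; apply/seteqP; split => _ [x _ <-].
  by exists (x - x0) => //; rewrite F0_translate.
by exists (x + x0) => //; rewrite F0_translate addrK.
Qed.

Lemma subdiff_translate x : subdiff (g (translate x0 P)) x = subdiff (g P) (x - x0).
Proof.
apply/seteqP; split => v [fin sub]; split.
- by rewrite -g_translate.
- move=> z; have := sub (z + x0).
  by rewrite !g_translate addrK opprB addrA.
- by rewrite g_translate.
- move=> z; have := sub (z - x0).
  by rewrite !g_translate opprB addrA subrK.
Qed.

Lemma stationary_translate eps x :
  stationary eps (translate x0 P) x -> stationary eps P (x - x0).
Proof.
move=> [gamma]; rewrite subdiff_translate grad_shift /= => H; exists gamma.
by rewrite mulmxBr addrAC -addrA.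
Qed.

End Translation.

(** * A weighted l1 norm of an affine map is proper, lower semicontinuous and convex *)

Section WeightedNorm.
Context {R : realType} (n p : nat) (c : R) (B : 'M[R]_(p, n)) (b : 'cV[R]_p).
Hypothesis c0 : 0 <= c.

Lemma continuous_norm1_affine : continuous (fun y => c * norm1 (B *m y + b)).
Proof.
move=> y; apply: (@continuous_comp _ _ _ (fun y => norm1 (B *m y + b)) ( *%R c)).
  2: exact: mulrl_continuous.
move: y.
apply: continuous_big => [|k _]; first exact: add_continuous.
move=> x; apply: (@continuous_comp _ _ _ (fun x => (B *m x + b) k 0)).
  have -> : (fun x => (B *m x + b) k 0) =
      (fun x : 'cV_n => \sum_j B k j * x j 0) + cst (b k 0).
    by apply/funext => z; rewrite !mxE.
  apply: continuousD; last exact: cst_continuous.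
  have dB : is_diff x (fun x : 'cV_n => \sum_j B k j * x j 0)
      (fun v : 'cV_n => \sum_j B k j * v j 0).
    by apply: is_diff_sum => j _; apply: is_diffZl; exact: is_diff_coord.
  suff : differentiable (fun x : 'cV[R]_n => \sum_j B k j * x j 0) x.
    exact: differentiable_continuous.
  exact: ex_diff.
exact: norm_continuous.
Qed.

Lemma norm1_affine_convex (x y : 'cV[R]_n) (s : R) : 0 <= s <= 1 ->
  norm1 (B *m (s *: x + (1 - s) *: y) + b) <=
  s * norm1 (B *m x + b) + (1 - s) * norm1 (B *m y + b).
Proof.
move=> /andP[s0 s1]; have t0 : 0 <= 1 - s by rewrite subr_ge0.
rewrite !mulr_sumr -big_split /=; apply: ler_sum => k _.
have -> : B *m (s *: x + (1 - s) *: y) + b =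
    s *: (B *m x + b) + (1 - s) *: (B *m y + b).
  rewrite mulmxDr -!scalemxAr !scalerDr [RHS]addrACA -scalerDl.
  by rewrite (addrC s) subrK scale1r.
move: (B *m x + b) (B *m y + b) => u v; rewrite !mxE; apply: le_trans (ler_normD _ _) _.
by rewrite !normrM (ger0_norm s0) (ger0_norm t0).
Qed.

Lemma norm1_affine_proper_lsc_convex :
  proper_lsc_convex (fun y => (c * norm1 (B *m y + b))%:E).
Proof.
split; first by split => //; exists 0.
  move=> x a; rewrite lte_fin => ax.
  exists [set y | a < c * norm1 (B *m y + b)] => //.
  exact: (continuous_norm1_affine (lt_nbhsr ax)).
move=> x y s s01; rewrite -!EFinM -EFinD lee_fin !mulrA ![_ * c]mulrC -!mulrA -mulrDr.
by rewrite ler_wpM2l // norm1_affine_convex.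
Qed.

End WeightedNorm.

(** * Stationary points *)

Section Jumps.
Context {R : realType} (m1 m2 dbar : nat).
Notation m := (dim_m m1 m2).
Notation vec := 'cV[R]_(m * dbar).
Implicit Types (x : vec) (k : 'I_m.-1) (l : 'I_dbar).

Definition jump x k l : R := ent x (khi k) l - ent x (klo k) l.

(** The test vectors: e_l on the blocks p, p + 1, ... numbered from 0, and 0 before. The only jump
    is on edge p - 1, and there is none for p = 0. *)
Definition step (p : nat) l : vec :=
  \col_e ((p <= (mxtens_unindex e).1)%N && ((mxtens_unindex e).2 == l))%:R.

Lemma ent_step p l i l' : ent (step p l) i l' = ((p <= i)%N && (l' == l))%:R.
Proof. by rewrite /ent mxE mxtens_indexK. Qed.

Lemma dot_step x p l : dot x (step p l) = \sum_(i < m | (p <= i)%N) ent x i l.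
Proof.
rewrite dot_ent [RHS]big_mkcond; apply: eq_bigr => i _.
rewrite (bigD1 l) //= big1 => [|l' l'l]; rewrite ent_step.
  by rewrite eqxx andbT addr0; case: ifP => _; rewrite (mulr1, mulr0).
by rewrite (negbTE l'l) andbF mulr0.
Qed.

Lemma jump_step p l k l' :
  jump (step p l) k l' = ((p == k.+1) && (l' == l))%:R.
Proof.
rewrite /jump !ent_step /=; have [->|pk] := eqVneq p k.+1.
  by rewrite leqnn ltnn /= subr0.
by rewrite leq_eqVlt (negbTE pk) ltnS subrr.
Qed.

Lemma jumpD x y k l : jump (x + y) k l = jump x k l + jump y k l.
Proof. by rewrite /jump !entD opprD addrACA. Qed.

Lemma jumpZ c x k l : jump (c *: x) k l = c * jump x k l.
Proof. by rewrite /jump !entZ mulrBr. Qed.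

(** The difference telescopes over the jumps between the two blocks, and Cauchy-Schwarz applies. *)
Lemma sqr_entB_le x i i' l :
  (ent x i l - ent x i' l) ^+ 2 <= m%:R * \sum_k jump x k l ^+ 2.
Proof.
wlog ii' : i i' / (i' <= i)%N.
  move=> H; have [|/ltnW] := leqP i' i; first exact: H.
  by move=> /H; rewrite -sqrrN opprB.
pose V j := \sum_(i < m | i == j :> nat) ent x i l.
have VE (j : 'I_m) : V j = ent x j l.
  by rewrite /V (big_pred1 j).
have -> : ent x i l - ent x i' l = \sum_(k < m.-1 | (i' <= k < i)%N) jump x k l.
  rewrite -!VE -(@telescope_sumr _ i' i V ii').
  have im : (i <= m.-1)%N by have := ltn_ord i; lia.
  rewrite (big_nat_widen _ _ _ _ _ im) (@big_nat_widenl _ _ _ i' 0) // big_mkord.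
  apply: eq_big => k; first by rewrite andbC.
  by move=> _; rewrite /jump -!VE.
apply: le_trans (sqr_sum_le _ _) _.
rewrite ler_wpM2r ?ler_nat ?leq_pred //.
by apply: sumr_ge0 => k _; exact: sqr_ge0.
Qed.

End Jumps.

Lemma dotDl (R : realType) n (u v w : 'cV[R]_n) : dot (u + v) w = dot u w + dot v w.
Proof. by rewrite /dot -big_split; apply: eq_bigr => i _; rewrite mxE mulrDl. Qed.

Lemma dot_trmx (R : realType) n p (A : 'M[R]_(p, n)) u w :
  dot (A^T *m u) w = dot u (A *m w).
Proof.
have dotE q (a b : 'cV[R]_q) : dot a b = (a^T *m b) 0 0.
  by rewrite mxE; apply: eq_bigr => i _; rewrite mxE.
by rewrite !dotE trmx_mul trmxK mulmxA.
Qed.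

Lemma dot0 (R : realType) n (u : 'cV[R]_n) : dot u 0 = 0.
Proof. by rewrite /dot big1 // => i _; rewrite mxE mulr0. Qed.

Lemma dotZ (R : realType) n c (u v : 'cV[R]_n) : dot u (c *: v) = c * dot u v.
Proof. by rewrite /dot mulr_sumr; apply: eq_bigr => i _; rewrite mxE; ring. Qed.

Section Stationary.
Context {R : realType} (eps Lf beta : R) (m1 m2 dbar : nat).
Hypotheses (eps0 : 0 < eps) (Lf0 : 0 < Lf) (beta0 : 0 < beta)
  (m1_gt0 : (0 < m1)%N) (m2_gt0 : (0 < m2)%N).
Notation m := (dim_m m1 m2).
Notation vec := 'cV[R]_(m * dbar).
Notation step_vec := (@step R m1 m2 dbar).
Notation P0 := (inst eps Lf m1 m2 dbar beta).
Implicit Types (x : vec).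

Let m0 : 0 < m%:R :> R. Proof. exact: dim_m_gt0. Qed.

Definition tv x : R := beta * \sum_(k in calM m1 m2) \sum_l `|jump x k l|.

Lemma g_instE x : g P0 x = (tv x)%:E.
Proof.
rewrite /g /= addr0 /gbar_inst; congr EFin; rewrite norm1_ent /tv.
have -> : \sum_i \sum_l `|ent (Abar_inst Lf m1 m2 dbar *m x) i l| =
    m%:R * Lf * \sum_(k in calM m1 m2) \sum_l `|jump x k l|.
  rewrite [in RHS]big_enum_val mulr_sumr; apply: eq_bigr => a _.
  rewrite mulr_sumr; apply: eq_bigr => l _.
  by rewrite (@ent_rows R Lf m1 m2 dbar (calM m1 m2)) normrM gtr0_norm ?mulr_gt0.
by rewrite mulrA divfK // gt_eqF ?mulr_gt0.
Qed.

Lemma subdiff_inst x v w : v \in subdiff (g P0) x -> tv x + dot v w <= tv (x + w).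
Proof.
rewrite inE => -[_ /(_ (x + w))]; rewrite !g_instE.
by rewrite [x + w - x]addrAC subrr add0r -EFinD lee_fin.
Qed.

(** The single jump of such a vector, if any, lies on an edge of [calM], which is not a row of A.
    Testing against it therefore eliminates the multiplier [gamma]. *)
Lemma A_step p l : p = 0%N \/ (exists2 k, k \in calM m1 m2 & p = k.+1) ->
  A_inst Lf m1 m2 dbar *m step_vec p l = 0.
Proof.
move=> pM; apply: entP => a l'; rewrite ent0.
rewrite (@ent_rows R Lf m1 m2 dbar (calMC m1 m2)) -/(jump _ _ _) jump_step.
case: pM => [->|[k kM ->]]; first by rewrite mulr0.
rewrite eqSS [X in X && _](_ : _ = false) ?mulr0 //; apply/negbTE.
apply: contraL (enum_valP a) => /eqP/val_inj <-.
by rewrite inE kM.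
Qed.

Lemma tv_step0 x s l : tv (x + s *: step_vec 0 l) = tv x.
Proof.
rewrite /tv; congr (_ * _); apply: eq_bigr => k _; apply: eq_bigr => l' _.
by rewrite jumpD jumpZ jump_step mulr0 addr0.
Qed.

(** This move closes the jump on edge k in coordinate l and changes no other jump. *)
Lemma tv_step x k l : k \in calM m1 m2 ->
  tv (x - jump x k l *: step_vec k.+1 l) = tv x - beta * `|jump x k l|.
Proof.
move=> kM; rewrite /tv -mulrBr; congr (_ * _).
rewrite (bigD1 k) //= [in RHS](bigD1 k) //= addrAC; congr (_ + _); last first.
  apply: eq_bigr => k' /andP[_ k'k]; apply: eq_bigr => l' _.
  rewrite -scaleNr jumpD jumpZ jump_step eqSS eq_sym val_eqE (negbTE k'k) /=.
  by rewrite mulr0 addr0.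
rewrite (bigD1 l) //= [in RHS](bigD1 l) //= -scaleNr.
rewrite jumpD jumpZ jump_step !eqxx mulr1 subrr normr0 add0r addrAC subrr add0r.
apply: eq_bigr => l' /negbTE l'l.
by rewrite jumpD jumpZ jump_step eqxx l'l mulr0 addr0.
Qed.

(** * From a small residual and near feasibility to large coordinates *)

Section Core.
Variables (x gr v : vec) (gamma : 'cV[R]_(#|calMC m1 m2| * dbar)).
Hypothesis grE : forall i (l : 'I_dbar), ent gr i l =
  2 * eps / Num.sqrt m%:R * hgrad m1 m2 i.+1 (zblock eps Lf x i) l.
Hypothesis vsub : v \in subdiff (g P0) x.
Hypothesis res : norm2 (gr + (A_inst Lf m1 m2 dbar)^T *m gamma + v) < 11 / 10 * eps.
Hypothesis feas : norm2 (A_inst Lf m1 m2 dbar *m x) <= eps.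
Hypothesis beta_big : (50 * pi + 1) * Num.sqrt m%:R * eps < beta.

Let r0 : 0 < Num.sqrt m%:R :> R. Proof. exact: sqrt_m_gt0. Qed.
Let rr : Num.sqrt m%:R ^+ 2 = m%:R :> R. Proof. exact: sqr_sqrt_m. Qed.

(** Pairing the residual with the test vector removes [gamma]; Cauchy-Schwarz over at most m blocks
    gives the factor sqrt m. *)
Let res_step p l : p = 0%N \/ (exists2 k, k \in calM m1 m2 & p = k.+1) ->
  `|\sum_(i < m | (p <= i)%N) ent gr i l + dot v (step_vec p l)| <=
  11 / 10 * eps * Num.sqrt m%:R.
Proof.
move=> pM; pose r := gr + (A_inst Lf m1 m2 dbar)^T *m gamma + v.
have rlt : norm2 r < 11 / 10 * eps by exact: res.
have <- : dot r (step_vec p l) = \sum_(i < m | (p <= i)%N) ent gr i l + dot v (step_vec p l).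
  by rewrite !dotDl dot_trmx A_step // dot0 addr0 dot_step.
rewrite -ler_sqr ?nnegrE ?normr_ge0 //; last first.
  by rewrite !mulr_ge0 // ltW.
rewrite real_normK ?num_real // dot_step; apply: le_trans (sqr_sum_le _ _) _.
rewrite exprMn rr mulrC ler_wpM2r ?(ltW m0) //.
apply: (@le_trans _ _ (norm2 r ^+ 2)); last first.
  by rewrite ler_sqr ?nnegrE ?norm2_ge0 // ltW // (le_lt_trans (norm2_ge0 r)).
rewrite sqr_norm2_ent; apply: ler_sum => i _; rewrite (bigD1 l) //= lerDl.
by apply: sumr_ge0 => l' _; exact: sqr_ge0.
Qed.

(** If the jump were nonzero, the subgradient inequality for the move closing it would give beta <=
    |<v, step>|. The residual and gradient bounds give |<v, step>| <= (24 pi + 25.1) sqrt m eps,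
    which is below beta. *)
Let jumpM k l : k \in calM m1 m2 -> jump x k l = 0.
Proof.
move=> kM; apply/eqP; apply: contraT => jn0.
have := res_step l (or_intror (ex_intro2 _ _ k kM erefl)).
set S := \sum_(i < m | _) _.
have Sle : `|S| <= Num.sqrt m%:R * (2 * eps * (12 + 12 * pi)).
  have -> : Num.sqrt m%:R * (2 * eps * (12 + 12 * pi)) =
      \sum_(i < m) 2 * eps / Num.sqrt m%:R * (12 + 12 * pi).
    rewrite sumr_const card_ord -[RHS]mulr_natl.
    move: r0 rr; move: (Num.sqrt m%:R : R) (@pi R) => r q rpos <-.
    by field; rewrite gt_eqF.
  apply: le_trans (ler_norm_sum _ _ _) _; rewrite big_mkcond /=.
  have c0 : 0 <= 2 * eps / Num.sqrt m%:R.
    by rewrite divr_ge0 ?mulr_ge0 // ltW.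
  apply: ler_sum => i _; case: ifP => _; last first.
    by rewrite mulr_ge0 // addr_ge0 // mulr_ge0 // pi_ge0.
  by rewrite grE normrM (ger0_norm c0) ler_wpM2l // norm_hgrad.
have := subdiff_inst (- jump x k l *: step_vec k.+1 l) vsub.
rewrite dotZ scaleNr tv_step // lerD2l.
set t := dot v _ => vt resS.
have tge : beta <= `|t|.
  rewrite -(@ler_pM2r _ `|jump x k l|) ?normr_gt0 //.
  have : jump x k l * t <= `|t| * `|jump x k l|.
    by rewrite mulrC -normrM ler_norm.
  by lra.
have tle : `|t| <= `|S + t| + `|S|.
  by rewrite -{1}(addKr S t) addrC; apply: le_trans (ler_normB _ _) _.
have pi2 := @pi_ge2 R.
have re0 : 0 < Num.sqrt m%:R * eps by rewrite mulr_gt0.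
have : 0 < (26 * pi - 48) * (Num.sqrt m%:R * eps) by rewrite mulr_gt0 //; lra.
by have := beta_big; lra.
Qed.

(** The jumps on [calM] are 0, and the others are the entries of A x divided by m Lf. *)
Let jump_sum l : \sum_k jump x k l ^+ 2 <= (eps / (m%:R * Lf)) ^+ 2.
Proof.
rewrite (bigID (mem (calM m1 m2))) /= big1 ?add0r => [|k /jumpM ->]; last first.
  by rewrite expr0n.
rewrite (eq_bigl (mem (calMC m1 m2))) => [|k]; last first.
  by rewrite -[RHS]/(k \in calMC m1 m2) finset.in_setC.
rewrite expr_div_n ler_pdivlMr ?exprn_gt0 ?mulr_gt0 //.
apply: (@le_trans _ _ (norm2 (A_inst Lf m1 m2 dbar *m x) ^+ 2)); last first.
  by rewrite ler_sqr ?nnegrE ?norm2_ge0 // ltW.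
rewrite sqr_norm2_ent big_enum_val mulr_suml; apply: ler_sum => a _.
rewrite (bigD1 l) //= (@ent_rows R Lf m1 m2 dbar (calMC m1 m2)).
rewrite -exprMn mulrC -/(jump _ _ _) lerDl.
by apply: sumr_ge0 => l' _; exact: sqr_ge0.
Qed.

Let xcoord_close i i' j :
  `|xcoord (zblock eps Lf x i) j - xcoord (zblock eps Lf x i') j| <= (150 * pi)^-1.
Proof.
have pi0 := @pi_gt0 R; have c0 : 0 < (150 * pi)^-1 :> R.
  by rewrite invr_gt0 mulr_gt0.
case: j => [|j]; first by rewrite subrr normr0 ltW.
have [jd|dj] := ltnP j dbar; last by rewrite !xcoord_out // subrr normr0 ltW.
rewrite (xcoordS _ (Ordinal jd)) (xcoordS _ (Ordinal jd)) !zblockE -mulrBr.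
rewrite -ler_sqr ?nnegrE ?normr_ge0 ?(ltW c0) //.
rewrite real_normK ?num_real // exprMn.
apply: le_trans (ler_wpM2l (sqr_ge0 _) (sqr_entB_le _ _ _ _)) _.
apply: le_trans (ler_wpM2l (sqr_ge0 _) (ler_wpM2l (ltW m0) (jump_sum _))) _.
(* [zscale]^2 * m * (eps / (m Lf))^2 = 1 / (150 pi)^2. *)
rewrite le_eqVlt; apply/orP; left; apply/eqP; rewrite /zscale.
move: r0 rr pi0; move: (Num.sqrt m%:R : R) (@pi R) => r q rpos <- qpos.
by field; rewrite !gt_eqF.
Qed.

(** g is invariant when the same vector is added to all blocks, so v is orthogonal to
    [step_vec 0 k]. Dividing the bound 11/10 eps sqrt m by 2 eps / sqrt m leaves 11/20 m. *)
Let sum_hgrad_small (k : 'I_dbar) :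
  `|\sum_(i < m) hgrad m1 m2 i.+1 (zblock eps Lf x i) k| <= 11 / 20 * m%:R.
Proof.
have v0 : dot v (step_vec 0 k) = 0.
  have := subdiff_inst (1 *: step_vec 0 k) vsub.
  have := subdiff_inst ((- 1) *: step_vec 0 k) vsub.
  by rewrite !tv_step0 !dotZ; lra.
have := res_step k (or_introl erefl); rewrite v0 addr0.
under eq_bigr do rewrite grE.
have e0 := eps0; rewrite -mulr_sumr normrM gtr0_norm ?divr_gt0 ?mulr_gt0 //.
move: r0 rr; move: (Num.sqrt m%:R : R) => r rpos <-.
move: (`|_|) => S; rewrite -ler_pdivlMl ?divr_gt0 ?mulr_gt0 //.
move=> /le_trans; apply; rewrite le_eqVlt; apply/orP; left; apply/eqP.
by field; rewrite !gt_eqF.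
Qed.

(** Let k + 1 be the first rescaled coordinate of block i of modulus < 1. The one before has modulus
    >= 1, position 0 holding the constant 1, so the averaged gradient at block i is below -10/9.
    Passing to the actual blocks changes it by at most 1/2, and 10/9 - 1/2 = 11/18 > 11/20 is a
    contradiction. *)
Lemma coord_ge1 i (l : 'I_dbar) : 1 <= `|zblock eps Lf x i l 0|.
Proof.
rewrite -xcoordS; set z := zblock eps Lf x i; rewrite leNgt; apply/negP => zl.
have ex : exists k : nat, (k < dbar)%N && (`|xcoord z k.+1| < 1).
  by exists l; rewrite ltn_ord.
case: (ex_minnP ex) => k /andP[kd zk] kmin.
have zk1 : 1 <= `|xcoord z k|.
  case: k kd zk kmin => [|k] kd zk kmin; first by rewrite /xcoord normr1.
  rewrite leNgt; apply/negP => zk1.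
  by have := kmin k; rewrite zk1 (ltnW kd) ltnn => /(_ isT).
pose g0 : R := pairf_r (xcoord z k) (xcoord z k.+1) +
  (if (k.+1 < dbar)%N then pairf_l (xcoord z k.+1) (xcoord z k.+2) else 0).
have g0_lt : g0 < - (10 / 9).
  have := pairf_r_lt zk1 zk; rewrite /g0; case: ifP => _; last by rewrite addr0.
  by have := pairf_l_le0 (xcoord z k.+1) (xcoord z k.+2); lra.
have sumE : \sum_(i < m) hgrad m1 m2 i.+1 z k = m%:R * g0.
  rewrite /hgrad big_split /= -mulr_suml sum_weight /g0 mulrDr; congr (_ + _).
  by case: ifP => _; [rewrite -mulr_suml sum_weight | rewrite big1 ?mulr0].
(* (48 pi + 48) / (150 pi) <= 72 / 150 < 1/2, since pi >= 2. *)
have close (i' : 'I_m) : `|hgrad m1 m2 i'.+1 z k -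
    hgrad m1 m2 i'.+1 (zblock eps Lf x i') k| <= 2^-1.
  apply: le_trans (hgrad_lipschitz _ _ _ _ _ _) _.
  have pi2 := @pi_ge2 R.
  have c := xcoord_close i i'; set t := (150 * pi)^-1 in c.
  have tE : 150 * pi * t = 1 by rewrite mulfV // gt_eqF // mulr_gt0 // pi_gt0.
  have t0 : 0 <= t by rewrite invr_ge0 mulr_ge0 // pi_ge0.
  have := c k; have := c k.+1; have := c k.+2; rewrite -/z.
  move: (`|_|) (`|_|) (`|_|) => a b d ct bt at_.
  have : (48 * pi + 12) * b <= (48 * pi + 12) * t.
    by rewrite ler_wpM2l // addr_ge0 // mulr_ge0 // pi_ge0.
  have : 0 <= (pi - 2) * t by rewrite mulr_ge0 // subr_ge0.
  by lra.
have : `|\sum_(i < m) hgrad m1 m2 i.+1 z k -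
    \sum_(i < m) hgrad m1 m2 i.+1 (zblock eps Lf x i) k| <= m%:R * 2^-1.
  rewrite -sumrB; apply: le_trans (ler_norm_sum _ _ _) _.
  apply: le_trans (ler_sum _ (fun i' _ => close i')) _.
  by rewrite sumr_const card_ord mulr_natl.
have := sum_hgrad_small (Ordinal kd); rewrite sumE /= !ler_norml.
move=> /andP[lo _] /andP[hi _]; move: lo hi; set T := \sum_(i < m) _ => lo hi.
have : m%:R * g0 < m%:R * - (10 / 9) by rewrite ltr_pM2l.
by have := m0; lra.
Qed.

End Core.
End Stationary.

Lemma opnorm_ge0 (R : realType) m n (M : 'M[R]_(m, n)) : 0 <= opnorm M.
Proof.
rewrite /opnorm; set S := (X in sup X).
have norm0 p : norm2 (0 : 'cV[R]_p) = 0.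
  by rewrite /norm2 big1 ?sqrtr0 // => i _; rewrite mxE expr0n.
have S0 : S 0 by exists 0; rewrite /= ?mulmx0 norm0 //.
(* The supremum of an unbounded set is 0 by default, so the sign is right in either case. *)
have [ubS|nubS] := pselect (has_ubound S); first exact: ub_le_sup.
by rewrite sup_out // => -[].
Qed.

(** * The lower bound *)

Section Main.
Context {R : realType} (eps Lf beta : R) (m1 m2 dbar : nat).
Hypotheses (eps0 : 0 < eps) (Lf0 : 0 < Lf) (m1_gt0 : (0 < m1)%N)
  (m2_gt0 : (0 < m2)%N) (dbar_odd : odd dbar).
Hypothesis beta_big : (50 * pi + 1) * Num.sqrt (dim_m m1 m2)%:R * eps < beta.
Notation m := (dim_m m1 m2).
Notation vec := 'cV[R]_(m * dbar).
Notation P0 := (inst eps Lf m1 m2 dbar beta).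
Implicit Types (x : vec).

Let beta0 : 0 < beta.
Proof.
apply: le_lt_trans beta_big; rewrite !mulr_ge0 ?(ltW eps0) //.
by rewrite addr_ge0 ?mulr_ge0 ?pi_ge0.
Qed.

Lemma stationary_coord x i (l : 'I_dbar) :
  stationary eps P0 x -> 1 <= `|zblock eps Lf x i l 0|.
Proof.
case=> gamma; rewrite ge_max => /andP[dist]; rewrite lee_fin /= addr0 => feas.
(* The distance is an infimum; any bound above eps is met by some subgradient, and 11/10 leaves
   enough slack. *)
have : (dist0 [set (grad (f0 P0) x + (mxA P0)^T *m gamma + v)%R
                 | v in subdiff (g P0) x] < (11 / 10 * eps)%:E)%E.
  by apply: le_lt_trans dist _; rewrite lte_fin; have := eps0; lra.
move=> /ereal_inf_lt[_ [_ [v vsub <-] <-]]; rewrite lte_fin => res.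
apply: (coord_ge1 eps0 Lf0 m1_gt0 m2_gt0 _ _ res feas beta_big).
- by move=> i' l'; exact: grad_f0.
- by rewrite inE.
Qed.

Lemma F0_inst_ge x :
  ((f0_inst eps Lf (0 : vec) - 1200 * pi ^+ 2 * eps ^+ 2 * dbar%:R / Lf)%:E
   <= F0 P0 x)%E.
Proof.
rewrite /F0 g_instE // -EFinD lee_fin; apply: le_trans (f0_inst_lower _ _ _ _ _ x) _ => //.
rewrite lerDl mulr_ge0 ?(ltW beta0) // sumr_ge0 // => k _.
by rewrite sumr_ge0.
Qed.

Lemma infF0_inst_ge :
  ((f0_inst eps Lf (0 : vec) - 1200 * pi ^+ 2 * eps ^+ 2 * dbar%:R / Lf)%:E
   <= infF0 P0)%E.
Proof. by apply: le_ereal_inf_tmp => _ [x _ <-]; exact: F0_inst_ge. Qed.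

Lemma Delta_inst_le x0 :
  Delta (translate x0 P0) x0 <= 1200 * pi ^+ 2 * eps ^+ 2 * dbar%:R / Lf.
Proof.
rewrite /Delta F0_translate subrr infF0_translate.
have F00 : F0 P0 0 = (f0_inst eps Lf (0 : vec))%:E.
  rewrite /F0 g_instE // -EFinD /tv big1 ?mulr0 ?addr0 // => k _.
  by rewrite big1 // => l _; rewrite /jump !ent0 subrr normr0.
have := infF0_inst_ge; have : (infF0 P0 <= F0 P0 0)%E by apply: ereal_inf_lbound; exists 0.
(* Both bounds together make the infimum finite, so that [fine] returns the true difference. *)
rewrite F00; case: (infF0 P0) => [r| |] //; rewrite !lee_fin => _ ?.
by rewrite -EFinB /=; lra.
Qed.

Lemma assumption1_inst x0 : assumption1 Lf (translate x0 P0).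
Proof.
split.
- move=> x; apply: differentiable_comp; last first.
    by have dx := is_diff_f0 eps Lf (m1 := m1) (m2 := m2) dbar_odd (x - x0); exact: ex_diff.
  by apply: differentiableB => //; exact: differentiable_cst.
- move=> x y; rewrite !grad_shift; apply: le_trans (grad_f0_lipschitz _ _ _ _ _ _ _) _ => //.
  by rewrite opprB addrA subrK.
- rewrite infF0_translate; apply: lt_le_trans infF0_inst_ge; exact: ltNyr.
- have -> : g (translate x0 P0) = fun y =>
      (beta / (m%:R * Lf) * norm1 (Abar_inst Lf m1 m2 dbar *m y +
         (0 - Abar_inst Lf m1 m2 dbar *m x0)))%:E by [].
  apply: norm1_affine_proper_lsc_convex.
  by rewrite divr_ge0 ?mulr_ge0 // ltW.
- have -> : gbar (translate x0 P0) = fun y =>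
      (beta / (m%:R * Lf) * norm1 (1%:M *m y + 0))%:E.
    by apply/funext => y; rewrite mul1mx addr0.
  apply: norm1_affine_proper_lsc_convex.
  by rewrite divr_ge0 ?mulr_ge0 // ltW.
Qed.

(** Were coordinate l of x - x0 zero in every block, x would differ from the stationary point by at
    least 1 / [zscale] in each of the m blocks, hence by at least 150 pi eps / Lf > omega in
    norm. *)
Lemma near_stationary_coord_neq0 omega x0 x (l : 'I_dbar) :
  0 <= omega < 150 * pi * eps / Lf ->
  near_stationary omega eps (translate x0 P0) x ->
  exists i, ent (x - x0) i l != 0.
Proof.
move=> /andP[om0 om] [xs [/stationary_translate st xxs]].
apply/existsP; apply: contraT => /existsPn x_eq0; exfalso.
suff : (150 * pi * eps / Lf) ^+ 2 <= omega ^+ 2.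
  rewrite ler_sqr ?nnegrE ?divr_ge0 ?mulr_ge0 ?pi_ge0 ?(ltW Lf0) ?(ltW eps0) //.
  by rewrite leNgt om.
apply: (@le_trans _ _ (norm2 (x - xs) ^+ 2)); last first.
  by rewrite ler_sqr ?nnegrE ?norm2_ge0.
rewrite sqr_norm2_ent.
have s0 := zscale_gt0 (eps := eps) (Lf := Lf) eps0 Lf0 m1_gt0 m2_gt0.
set s := zscale eps Lf m1 m2 in s0.
have -> : (150 * pi * eps / Lf) ^+ 2 = \sum_(i < m) s ^- 2.
  rewrite sumr_const card_ord -[RHS]mulr_natl /s /zscale.
  have : 0 < Num.sqrt m%:R :> R by exact: sqrt_m_gt0.
  have : Num.sqrt m%:R ^+ 2 = m%:R :> R by exact: sqr_sqrt_m.
  have := @pi_gt0 R; move: (@pi R) (Num.sqrt m%:R : R) => q r q0 <- rpos.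
  by field; rewrite !gt_eqF.
apply: ler_sum => i _; apply: (@le_trans _ _ (ent (x - xs) i l ^+ 2)); last first.
  by rewrite (bigD1 l) //= lerDl sumr_ge0 // => l' _; exact: sqr_ge0.
have -> : ent (x - xs) i l = - ent (xs - x0) i l.
  have /negPn/eqP := x_eq0 i; rewrite !entB => /eqP.
  by rewrite subr_eq0 => /eqP ->; rewrite opprB.
have := stationary_coord i l st; rewrite zblockE => ge1.
rewrite sqrrN -[_ ^- 2]mul1r ler_pdivrMr ?exprn_gt0 // -exprMn mulrC.
rewrite -[leRHS]real_normK ?num_real // -{1}(expr1n R 2).
by rewrite ler_sqr ?nnegrE.
Qed.

End Main.

(** * Arithmetic of the iteration count and conclusion *)

Lemma oracle_bound (R : realFieldType) (eps Lf q K M Delta d : R) :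
  0 < eps -> 0 < Lf -> 0 < q -> 0 <= d -> 0 <= K -> K <= 2 * M ->
  Delta <= 1200 * q ^+ 2 * eps ^+ 2 * d / Lf ->
  K * Lf * Delta / (18000 * q ^+ 2) * eps ^- 2 <= 2 / 15 * M * d.
Proof.
move=> eps0 Lf0 q0 d0 K0 KM Dle.
have -> : K * Lf * Delta / (18000 * q ^+ 2) * eps ^- 2 =
    K * (Delta * (Lf / (18000 * (q * eps) ^+ 2))).
  by field; rewrite !gt_eqF.
have c0 : 0 < Lf / (18000 * (q * eps) ^+ 2).
  have n0 : 0 < 18000%:R :> R by rewrite ltr0n.
  exact: divr_gt0 Lf0 (mulr_gt0 n0 (exprn_gt0 2 (mulr_gt0 q0 eps0))).
apply: le_trans (ler_wpM2l K0 (ler_wpM2r (ltW c0) Dle)) _.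
(* 1200 / 18000 = 1/15. *)
have -> : 1200 * q ^+ 2 * eps ^+ 2 * d / Lf * (Lf / (18000 * (q * eps) ^+ 2)) =
    d / 15.
  by field; rewrite !gt_eqF.
by move: (ler_wpM2r d0 KM); clear; lra.
Qed.

(** The left side is 2/5 D d, and 2/5 d <= d - 2 for d >= 5. *)
Lemma two_fifths_le (R : realFieldType) (d D t : nat) : (5 <= d)%N ->
  ((d - 2) * D <= t)%N -> 2 / 15 * (3 * D)%:R * d%:R <= t%:R :> R.
Proof.
move=> d5 Dt; apply: (@le_trans _ _ ((d - 2) * D)%:R); last by rewrite ler_nat.
have d2 : (2 <= d)%N by lia.
have -> : ((d - 2) * D)%:R = (d%:R - 2) * D%:R :> R by rewrite natrM natrB.
have -> : (3 * D)%:R = 3 * D%:R :> R by rewrite natrM.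
have d4 : 0 <= d%:R - 4 :> R by rewrite subr_ge0 ler_nat ltnW.
by have := mulr_ge0 (ler0n R D) d4; have := ler0n R D; lra.
Qed.

Theorem corollary3p1 (R : realType) (eps Lf : R) (m1 m2 dbar : nat) (beta omega : R)
    (heps : 0 < eps) (hLf : 0 < Lf)
    (hm1 : (2 <= m1)%N) (hm1_even : ~~ odd m1) (hm2 : (1 <= m2)%N)
    (hdbar : (5 <= dbar)%N) (hdbar_odd : odd dbar)
    (hbeta : (50 * pi + 1 + opnorm (A_inst Lf m1 m2 dbar)) *
             Num.sqrt (dim_m m1 m2)%:R * eps < beta)
    (homega : 0 <= omega < 150 * pi * eps / Lf)
    (x0 : 'cV[R]_(dim_m m1 m2 * dbar)) (y0 : 'cV[R]_(#|calM m1 m2| * dbar)) :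
  let P0 := inst eps Lf m1 m2 dbar beta in
  let P := translate x0 P0 in
  assumption1 Lf P /\
  forall (x : nat -> 'cV[R]_(dim_m m1 m2 * dbar))
         (y : nat -> 'cV[R]_(#|calM m1 m2| * dbar)),
    x 0%N = x0 -> y 0%N = y0 ->
    linear_span P0 (fun t => x t - x0) (fun t => y t - y0) ->
    forall t : nat, near_stationary omega eps P (x t) ->
      Num.ceil (kappa (col_mx (mxAbar P) (mxA P)) * Lf * Delta P x0
                / (18000 * pi ^+ 2) * eps ^- 2) <= t%:Z.
Proof.
move=> P0 P; have m1_gt0 : (0 < m1)%N := ltnW hm1.
have beta_big : (50 * pi + 1) * Num.sqrt (dim_m m1 m2)%:R * eps < beta.
  apply: le_lt_trans hbeta; rewrite ler_wpM2r ?(ltW heps) // ler_wpM2r //.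
  by rewrite lerDl opnorm_ge0.
have beta0 : 0 < beta.
  apply: le_lt_trans beta_big; rewrite !mulr_ge0 ?(ltW heps) //.
  by rewrite addr_ge0 ?mulr_ge0 ?pi_ge0.
split=> [|x y xE yE xy t near_t]; first exact: assumption1_inst.
have dbar_gt0 : (0 < dbar)%N by exact: leq_trans hdbar.
have last_lt : (dbar.-1 < dbar)%N by rewrite prednK.
have [i xt_neq0] := near_stationary_coord_neq0 heps hLf m1_gt0 hm2 hdbar_odd
  beta_big (Ordinal last_lt) homega near_t.
(* Before iteration [tau] of the last coordinate the zero chain keeps that coordinate of x t - x0 at
   0, contradicting [xt_neq0]. *)
have t_ge : ((dbar - 2) * (m1 * m2) <= t)%N.
  apply: leq_trans (tau_ge m1 m2 i.+1 dbar) _.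
  rewrite leqNgt; apply: contra xt_neq0 => lt_t; apply/eqP.
  apply: (zero_chain heps beta0 hLf m1_gt0 hm2 hdbar_odd _ _ xy).
  - by rewrite xE subrr.
  - by rewrite yE subrr.
  - by rewrite /= prednK.
have /andP[kappa0 kappa_le2m] : 0 <= kappa (col_mx (mxAbar P) (mxA P)) <=
    2 * (dim_m m1 m2)%:R.
  by apply: kappa_le => //; rewrite dim_mE !muln_gt0 m1_gt0.
have Delta_le := Delta_inst_le heps hLf m1_gt0 hm2 hdbar_odd beta_big x0.
rewrite Num.Theory.ceil_le_int.
apply: le_trans (oracle_bound heps hLf (pi_gt0 R) _ kappa0 kappa_le2m Delta_le) _ => //.
by rewrite dim_mE; exact: two_fifths_le.
Qed.
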